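(* Let $n \geq 1$ be an integer. There is an integer $d_0 = d_0(n)$ such that for every integer $d \geq d_0$ the following holds. Let $X \subseteq \mathbb{P}^{n+1}_{\mathbb{C}}$ be a very general smooth Calabi-Yau hypersurface of dimension $n$ (that is, a very general smooth hypersurface of degree $n+2$). Then for all integers $p, q$ with $p \leq (q-1)d - 3$, $$K_{p,q}(X, \mathscr{O}_X(d)) = 0 .$$
   Context: All varieties are over $\mathbb{C}$. For a projective variety $X$, a line bundle $\mathscr{B}$ and a very ample line bundle $\mathscr{L}$ on $X$, put $V = H^0(X,\mathscr{L})$ and write $q\mathscr{L} = \mathscr{L}^{\otimes q}$. The Koszul cohomology group $K_{p,q}(X,\mathscr{B},\mathscr{L})$ is the cohomology at the middle term of the complex $$\bigwedge^{p+1} V \otimes H^0(\mathscr{B}\otimes (q-1)\mathscr{L}) \xrightarrow{\partial} \bigwedge^{p} V \otimes H^0(\mathscr{B}\otimes q\mathscr{L}) \xrightarrow{\partial} \bigwedge^{p-1} V \otimes H^0(\mathscr{B}\otimes (q+1)\mathscr{L}),$$ with differential $\partial(v_0\wedge\dots\wedge v_p\otimes m) = \sum_{k=0}^p (-1)^k v_0\wedge\dots\wedge\widehat{v_k}\wedge\dots\wedge v_p\otimes v_k m$ (exterior powers with negative exponent are zero). When $\mathscr{B} = \mathscr{O}_X$ one writes $K_{p,q}(X,\mathscr{L})$. Here $\mathscr{O}_X(d)$ is the restriction of $\mathscr{O}_{\mathbb{P}^{n+1}}(d)$. ''Very general'' means: corresponding to a point outside some countable union of proper closed subvarieties of the projective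 space parametrizing hypersurfaces of degree $n+2$ in $\mathbb{P}^{n+1}$. *)

(* Defs.v *)
From mathcomp Require Import all_boot all_order all_algebra.
From mathcomp Require Import boolp classical_sets functions reals.
From mathcomp Require Import complex.
From mathcomp Require Import freeg mpoly.

Set Implicit Arguments.
Unset Strict Implicit.
Unset Printing Implicit Defensive.

Import GRing.Theory.

Local Open Scope ring_scope.

Section Koszul.
Variables (C : fieldType) (T : Type).
Implicit Types (V M : set (T -> C)) (p : int).

(* The vector space [wedge^p V (x) M], for linear subspaces [V] and [M] of the
   space of functions [T -> C], is presented by generators and relations: the
   pair [(v, m)] stands for the pure tensor
   [v_0 /\ ... /\ v_(p-1) (x) m], and the vector space is the quotient of
   [{c | wedge_chain V M p c}] by its subspace [{c | wedge_null V M p c}].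
   There are no generators when [p < 0]. The ring operations on functions are
   pointwise, so [cst a * v] is [v] scaled by [a]. *)
Definition wedge_gen := (seq (T -> C) * (T -> C))%type.

Definition pure (v : seq (T -> C)) (m : T -> C) : {freeg wedge_gen / C} :=
  << (v, m) >>.

Definition is_gen V M p (g : wedge_gen) : Prop :=
  [/\ (size g.1)%:Z = p, (forall v, v \in g.1 -> V v) & M g.2].

Definition wedge_chain V M p (c : {freeg wedge_gen / C}) : Prop :=
  forall g, coeff g c != 0 -> is_gen V M p g.

Inductive wedge_null V M p : {freeg wedge_gen / C} -> Prop :=
| wedge_null0 : wedge_null V M p 0
| wedge_nullD a c c' :
    wedge_null V M p c -> wedge_null V M p c' -> wedge_null V M p (a *: c + c')
| wedge_null_vec (a : C) (s t : seq (T -> C)) (v w m : T -> C) :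
    is_gen V M p (s ++ v :: t, m) -> is_gen V M p (s ++ w :: t, m) ->
    wedge_null V M p (pure (s ++ (cst a * v + w) :: t) m
                      - (a *: pure (s ++ v :: t) m + pure (s ++ w :: t) m))
| wedge_null_coef (a : C) (v : seq (T -> C)) (m m' : T -> C) :
    is_gen V M p (v, m) -> is_gen V M p (v, m') ->
    wedge_null V M p (pure v (cst a * m + m') - (a *: pure v m + pure v m'))
| wedge_null_alt (s t u : seq (T -> C)) (v m : T -> C) :
    is_gen V M p (s ++ v :: t ++ v :: u, m) ->
    wedge_null V M p (pure (s ++ v :: t ++ v :: u) m).

Definition koszul_diff : {freeg wedge_gen / C} -> {freeg wedge_gen / C} :=
  fglift (fun g : wedge_gen =>
    \sum_(k < size g.1)
      (-1) ^+ k *: pure (take k g.1 ++ drop k.+1 g.1) (nth 0 g.1 k * g.2)).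

(* The cohomology at the middle term of
   [wedge^(p+1) V (x) M' -> wedge^p V (x) M -> wedge^(p-1) V (x) M'']
   vanishes: every cycle is a boundary. *)
Definition koszul_exact V (M' M M'' : set (T -> C)) p : Prop :=
  forall c, wedge_chain V M p c -> wedge_null V M'' (p - 1) (koszul_diff c) ->
  exists2 b, wedge_chain V M' (p + 1) b & wedge_null V M p (c - koszul_diff b).

End Koszul.

Section Hypersurface.
Variables (C : fieldType) (r : nat).
Implicit Types F G H : {mpoly C[r]}.

(* Points of the punctured affine cone over the hypersurface [F = 0] in
   [P^(r-1)]. *)
Definition cone F : Type :=
  {x : 'I_r -> C | (exists i, x i != 0) /\ F.@[x] = 0}.

(* The Jacobian criterion. Over an algebraically closed field it also forces
   the scheme [F = 0] to be reduced, so that regular functions on it are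
   determined by their values. *)
Definition smooth_hypersurface F : Prop :=
  forall x : cone F, exists i, (F^`M(i)).@[sval x] != 0.

(* [H^0(X, O_X(k))] for [X = {F = 0}] reduced and [k] an integer: the functions
   on the punctured cone which, near every point, are a quotient of two
   homogeneous polynomials of degrees differing by [k]. Such functions are
   automatically homogeneous of degree [k], and the product of sections
   [O_X(k) (x) O_X(l) -> O_X(k + l)] is the product of functions. *)
Definition section_space F (k : int) : set (cone F -> C) :=
  fun s => forall x : cone F, exists (i j : nat) G H,
    [/\ G \is i.-homog, H \is j.-homog, i%:Z - j%:Z = k,
        H.@[sval x] != 0 &
        forall y : cone F, H.@[sval y] != 0 ->
          s y = G.@[sval y] / H.@[sval y]].

(* [K_{p,q}(X, O_X(d)) = 0] for [X = {F = 0}]. *)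
Definition koszul_vanishes F (d p q : int) : Prop :=
  koszul_exact (section_space (F := F) d)
    (section_space (F := F) ((q - 1) * d))
    (section_space (F := F) (q * d))
    (section_space (F := F) ((q + 1) * d)) p.

(* A point of the projective space of hypersurfaces of degree [e] in [P^(r-1)]
   is a nonzero form of degree [e] up to scalars, and its homogeneous
   coordinates are its coefficients, indexed by the monomials of degree [e]. *)
Definition form_of_degree (e : nat) F : Prop := F \is e.-homog /\ F != 0.

Definition monomials (e : nat) : finType :=
  {m : 'X_{1..r < e.+1} | mdeg m == e}.

Definition form_coefs (e : nat) F (i : 'I_#|monomials e|) : C :=
  F@_(val (val (enum_val i))).

Definition proper_closed (e : nat) (Z : set {mpoly C[r]}) : Prop :=
  (exists I : set {mpoly C[#|monomials e|]},
     (forall g, I g -> exists k : nat, g \is k.-homog) /\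
     (forall F, form_of_degree e F ->
        Z F <-> forall g, I g -> g.@[form_coefs F] = 0)) /\
  (exists2 F, form_of_degree e F & ~ Z F).

(* A very general smooth hypersurface of degree [e] satisfies [P]. *)
Definition for_very_general_smooth (e : nat) (P : {mpoly C[r]} -> Prop) : Prop :=
  exists Z : nat -> set {mpoly C[r]},
    (forall i, proper_closed e (Z i)) /\
    (forall F, form_of_degree e F -> smooth_hypersurface F ->
       (forall i, ~ Z i F) -> P F).

End Hypersurface.

(* Main.v *)
(* Write [S] for the polynomial ring in [n + 2] variables and [e = n + 2] for the
   degree of [F]. Sections of [O_X(k)] are forms of degree [k] modulo [F], and the
   Koszul complex of [S/F] over [S_d] contains that of [S/F] over [(S/F)_d] as a
   direct summand. By the exact sequence [0 -> S(-e) -> S -> S/F -> 0], it is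
   enough that the Koszul homology [H_p] of [S] over [S_d] vanishes at coefficient
   degree [k] for [p + d <= k]; this is applied with [k = q * d] to
   [p] and with [k = (q + 1) * d - e] to [p - 1]. The closed set removed consists of
   the forms without the monomial [x_{n+1}^e]: outside it, forms modulo [F] are
   represented by forms of degree less than [e] in [x_{n+1}].

   In characteristic 0 a Koszul cycle is an antisymmetric element of
   [S_d^{(x) p} (x) S_k] whose contractions of any of the [p] slots with the
   coefficient vanish. Such tensors are the sections of the [p]-th tensor power of
   the kernel bundle of [O(d)], twisted by [k]. That bundle is 1-regular, so its
   power is [p]-regular and the module of these tensors is generated in degree
   [p]; this is proved by restricting to successive coordinate hyperplanes. A
   cycle is then [\sum_j x^j b_j] with cycles [b_j], hence the boundary of
   [\sum_j x^j /\ b_j]. *)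
From HB Require Import structures.
Require Import Defs.
From mathcomp Require Import all_boot all_order all_algebra.
From mathcomp Require Import boolp classical_sets functions reals.
From mathcomp Require Import complex.
From mathcomp Require Import freeg mpoly.
From mathcomp Require Import perm ring lra zify.
Set Implicit Arguments.
Unset Strict Implicit.
Unset Printing Implicit Defensive.
Import Order.TTheory GRing.Theory Num.Theory.
Local Open Scope ring_scope.

(** * Truncation of polynomials *)

(** Restriction to a hyperplane is the reason for working with plain tensors. On [x_k = 0] the
    kernel bundle of [O(d)] becomes the kernel bundle of the hyperplane plus a trivial summand
    spanned by the monomials divisible by [x_k]. A tensor power therefore breaks up according to the
    set of slots that lie in the trivial summand, and a single piece is no longer antisymmetric.
    Hence [syz] carries a set [A] of slots subject to contraction, while the other slots are
    parameters. The obstacle is to lift a piece back off the hyperplane so that its trivial slots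
    become syzygies too; [exchange] does this, at the cost of one degree per slot, and this cost is
    the bound [#|A| < e] for generation. Sections are functions that are only locally quotients of
    forms, so their description by forms modulo [F] has to be proved: the Nullstellensatz gives a
    polynomial on each chart, and a divisibility argument glues the charts. Forms of degree less
    than [e] in the last variable split [S_d -> (S/F)_d] linearly, so that wedge products of
    sections have determinants as coordinates. *)

Section Truncation.
Variables (K : fieldType) (r : nat).
Implicit Types (p q : {mpoly K[r]}) (m : 'X_{1..r}).

Lemma mcoeff_mulX p m k :
  (p * 'X_[m])@_k = if (m <= k)%MM then p@_(k - m)%MM else 0.
Proof.
case: ifP => [le_mk|nle_mk]; first by rewrite -{1}(submK le_mk) addmC mcoeffMX.
apply: memN_msupp_eq0; apply/negP; rewrite (perm_mem (msuppMX p m)).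
by case/mapP => m' _ k_eq; rewrite k_eq lem_addr in nle_mk.
Qed.

Definition mpoly_of_coeff (b : nat) (E : 'X_{1..r} -> K) : {mpoly K[r]} :=
  \sum_(m : 'X_{1..r < b}) E m *: 'X_[m].

Lemma mcoeff_of_coeff b E m :
  (mpoly_of_coeff b E)@_m = if (mdeg m < b)%N then E m else 0.
Proof.
case: ifP => [lt_mb|/negbT ge_mb]; first by rewrite mcoeff_mpoly.
rewrite raddf_sum big1 //= => m' _; rewrite mcoeffZ mcoeffX.
case: eqP => [m'E|_]; last by rewrite mulr0.
by rewrite -m'E bmdeg in ge_mb.
Qed.

(** Restriction to the hyperplane [x_k = 0]. *)
Definition mtrunc (k : 'I_r) p : {mpoly K[r]} :=
  mpoly_of_coeff (msize p) (fun m => if m k == 0%N then p@_m else 0).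

Lemma mcoeff_trunc k p m :
  (mtrunc k p)@_m = if m k == 0%N then p@_m else 0.
Proof.
rewrite mcoeff_of_coeff; case: ifP => // /negbT; rewrite -leqNgt => le_pm.
by rewrite (memN_msupp_eq0 (msize_mdeg_ge le_pm)) if_same.
Qed.

Lemma mtrunc_is_linear k : linear (mtrunc k).
Proof.
move=> c p q; apply/mpolyP => m.
rewrite mcoeffD mcoeffZ !mcoeff_trunc mcoeffD mcoeffZ.
by case: ifP; rewrite ?mulr0 ?addr0.
Qed.

HB.instance Definition _ k :=
  GRing.isLinear.Build K {mpoly K[r]} {mpoly K[r]} _ (mtrunc k)
    (mtrunc_is_linear k).

Lemma mtrunc_id k p : mtrunc k (mtrunc k p) = mtrunc k p.
Proof. by apply/mpolyP => m; rewrite !mcoeff_trunc; case: eqP. Qed.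

Lemma mtruncMX k p m :
  mtrunc k (p * 'X_[m]) = if m k == 0%N then mtrunc k p * 'X_[m] else 0.
Proof.
apply/mpolyP => l; rewrite mcoeff_trunc mcoeff_mulX.
have [mk0|mk0] := eqVneq (m k) 0%N.
  rewrite mcoeff_mulX; case: (boolP (m <= l)%MM) => le_ml; last by rewrite if_same.
  by rewrite mcoeff_trunc mnmBE mk0 subn0.
rewrite mcoeff0; case: (eqVneq (l k) 0%N) => // lk0.
case: (boolP (m <= l)%MM) => // /mnm_lepP /(_ k).
by rewrite lk0 leqn0 (negbTE mk0).
Qed.

Definition mdivX (i : 'I_r) (N : nat) p : {mpoly K[r]} :=
  mpoly_of_coeff (msize p) (fun m => p@_(m + U_(i) *+ N)%MM).

Lemma mdivXK i N p : (forall m, m \in msupp p -> (N <= m i)%N) ->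
  mdivX i N p * 'X_i ^+ N = p.
Proof.
move=> pN; apply/mpolyP => m; rewrite mpolyXn mcoeff_mulX mcoeff_of_coeff.
have [m_p|m_p] := boolP (m \in msupp p); last first.
  rewrite (memN_msupp_eq0 m_p); case: ifP => // le_m.
  by rewrite submK // (memN_msupp_eq0 m_p) if_same.
have le_m : (U_(i) *+ N <= m)%MM.
  apply/mnm_lepP => j; rewrite mulmnE mnm1E; case: eqP => [<-|_] //.
  by rewrite mul1n pN.
by rewrite le_m submK // (leq_ltn_trans (mdegB _ _)) ?msize_mdeg_lt.
Qed.

Lemma mtrunc_eq k p q : mtrunc k p = mtrunc k q ->
  {c | p - q = c * 'X_k}.
Proof.
move=> eq_pq; exists (mdivX k 1 (p - q)).
rewrite -[in 'X_k](expr1 'X_k) mdivXK // => m; rewrite mcoeff_msupp.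
apply: contraR; rewrite -ltnNge ltnS leqn0 => mk0.
have := mcoeff_trunc k (p - q) m.
by rewrite mk0 linearB /= eq_pq subrr mcoeff0 => <-.
Qed.

End Truncation.

(** * Tensors killed by contractions *)

Section Syzygies.
Variables (K : fieldType) (r d : nat) (I : finType).
Local Notation S := {mpoly K[r]}.
Local Notation J := (monomials r d).
Local Notation slots := {ffun I -> J}.
Implicit Types (p q : S) (m : 'X_{1..r}) (s : slots) (A B : {set I}).
Implicit Types (a b : slots -> S).

Definition mon (j : J) : 'X_{1..r} := val (val j).

Lemma mdeg_mon j : mdeg (mon j) = d.
Proof. exact/eqP/(valP j). Qed.

Lemma mon_inj : injective mon.
Proof. by move=> i j eq_ij; apply/val_inj/val_inj. Qed.

Lemma mon_surj m : mdeg m = d -> exists j, mon j = m.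
Proof.
move=> md; have lt_md : (mdeg m < d.+1)%N by rewrite md.
have bm_d : mdeg (val (BMultinom lt_md)) == d by apply/eqP.
by exists (exist _ (BMultinom lt_md) bm_d).
Qed.

(** Monomials in [x_k, ..., x_(r-1)]: these are what remains after restriction to the first [k]
    coordinate hyperplanes. *)
Definition mlow (k : nat) m := [forall l : 'I_r, (l < k)%N ==> (m l == 0%N)].

Lemma mlowP k m : reflect (forall l : 'I_r, (l < k)%N -> m l = 0%N) (mlow k m).
Proof.
apply: (iffP forallP) => h l; first by move/(implyP (h l))/eqP.
by apply/implyP => /h ->.
Qed.

Lemma mlowS (k : 'I_r) m : mlow k.+1 m = (m k == 0%N) && mlow k m.
Proof.
apply/mlowP/andP => [h|[/eqP mk0 /mlowP h] l].
  split; first by rewrite h.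
  by apply/mlowP => l lt_lk; apply: h; apply: ltnW.
rewrite ltnS leq_eqVlt => /orP[/eqP lk|/h //].
by rewrite (_ : l = k) //; apply: val_inj.
Qed.

Definition hlow (k e : nat) p : Prop :=
  forall m, m \in msupp p -> mdeg m = e /\ mlow k m.

Lemma hlow0 k e : hlow k e 0.
Proof. by move=> m; rewrite msupp0. Qed.

Lemma hlowD k e p q : hlow k e p -> hlow k e q -> hlow k e (p + q).
Proof.
move=> hp hq m /msuppD_le; rewrite mem_cat => /orP[/hp|/hq] //.
Qed.

Lemma hlow_sum k e (T : Type) (l : seq T) (P : pred T) (F : T -> S) :
  (forall x, P x -> hlow k e (F x)) -> hlow k e (\sum_(x <- l | P x) F x).
Proof.
move=> hF; elim/big_ind: _ => //; [exact: hlow0|exact: hlowD].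
Qed.

Lemma hlowN k e p : hlow k e p -> hlow k e (- p).
Proof. by move=> hp m; rewrite (perm_mem (msuppN p)); apply: hp. Qed.

Lemma hlowMX k e p (l : 'I_r) : (k <= l)%N -> hlow k e p ->
  hlow k e.+1 (p * 'X_l).
Proof.
move=> le_kl hp m; rewrite (perm_mem (msuppMX p _)) => /mapP[m' /hp[<- lm'] ->].
rewrite mdegD mdeg1; split=> //; apply/mlowP => i lt_ik.
rewrite mnmDE (mlowP _ _ lm') // mnm1E; case: eqP => // l_i.
by rewrite l_i leqNgt lt_ik in le_kl.
Qed.

Lemma hlowMX_inv k e p (l : 'I_r) : hlow k e.+1 (p * 'X_l) -> hlow k e p.
Proof.
move=> hp m m_p.
have /hp[] : (U_(l) + m)%MM \in msupp (p * 'X_l).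
  by rewrite (perm_mem (msuppMX p _)) map_f.
rewrite mdegD mdeg1 => -[<-] /mlowP lm; split=> //; apply/mlowP => i /lm /eqP.
by rewrite mnmDE addn_eq0 => /andP[_ /eqP].
Qed.

Lemma hlow_mtrunc (k : 'I_r) e p : hlow k e p -> hlow k.+1 e (mtrunc k p).
Proof.
move=> hp m; rewrite mcoeff_msupp mcoeff_trunc.
have [mk0|_] := eqVneq (m k) 0%N; last by rewrite eqxx.
by rewrite -mcoeff_msupp => /hp[-> lm]; rewrite mlowS mk0 lm.
Qed.

Lemma hlow_weak (k : 'I_r) e p : hlow k.+1 e p -> hlow k e p.
Proof. by move=> hp m /hp[->]; rewrite mlowS => /andP[]. Qed.

Lemma hlow_last e p : (0 < e)%N -> hlow r e p -> p = 0.
Proof.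
move=> e_gt0 hp; apply/mpolyP => m; rewrite mcoeff0.
apply/memN_msupp_eq0/negP => /hp[m_e /mlowP lm].
move: e_gt0; rewrite -m_e mdegE big1 // => l _.
by rewrite lm.
Qed.

Definition upd s i j : slots := [ffun l => if l == i then j else s l].

Lemma updE s i j l : upd s i j l = if l == i then j else s l.
Proof. exact: ffunE. Qed.

Lemma upd_id s i j j' : upd (upd s i j) i j' = upd s i j'.
Proof. by apply/ffunP => l; rewrite !updE; case: eqP. Qed.

Lemma updC s i i' j j' : i != i' ->
  upd (upd s i j) i' j' = upd (upd s i' j') i j.
Proof.
move=> ne_ii'; apply/ffunP => l; rewrite !updE.
by case: (eqVneq l i') => // ->; rewrite eq_sym (negbTE ne_ii').
Qed.

(** The entry [s i] is overwritten, so the result is a tensor on the slots other than [i]. *)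
Definition contract a i s : S := \sum_j a (upd s i j) * 'X_[mon j].

(* A family [a] is the tensor [\sum_s (\bigotimes_i 'X_[mon (s i)]) (x) a s],
   with coefficients of degree [e]; it is a syzygy in the slots of [A]. *)
Definition syz (k : nat) A (e : nat) a : Prop :=
  [/\ forall s, hlow k e (a s),
      forall s i, i \in A -> a s != 0 -> mlow k (mon (s i))
    & forall s i, i \in A -> contract a i s = 0].

Lemma syz0 k A e : syz k A e (fun=> 0).
Proof.
split=> [s|s i _|s i _]; [exact: hlow0 | by rewrite eqxx|].
by rewrite /contract big1 // => j _; rewrite mul0r.
Qed.

Lemma syzD k A e a b : syz k A e a -> syz k A e b ->
  syz k A e (fun s => a s + b s).
Proof.
move=> [ha la ca] [hb lb cb]; split=> [s|s i iA|s i iA].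
- exact: hlowD.
- have [->|/la -> //] := eqVneq (a s) 0; rewrite add0r; exact: lb.
- rewrite /contract; under eq_bigr do rewrite mulrDl.
  by rewrite big_split /= [X in X + _](ca s i iA) [X in _ + X](cb s i iA) addr0.
Qed.

Lemma syz_sum k A e (T : Type) (l : seq T) (P : pred T) (F : T -> slots -> S) :
  (forall x, P x -> syz k A e (F x)) ->
  syz k A e (fun s => \sum_(x <- l | P x) F x s).
Proof.
move=> hF; elim: l => [|x l IH].
  by rewrite (_ : (fun _ => _) = fun=> 0);
    [exact: syz0 | apply: funext => s; rewrite big_nil].
rewrite (_ : (fun _ => _) = fun s =>
  (if P x then F x s else 0) + \sum_(x <- l | P x) F x s); last first.
  by apply: funext => s; rewrite big_cons; case: (P x); rewrite ?add0r.
apply: syzD => //; case: (boolP (P x)) => [/hF //|_]; exact: syz0.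
Qed.

(** A contraction of a slot of [A] only mixes families that agree elsewhere, and [P] takes the same
    value on all of them. *)
Lemma syz_cut k A e a (P : pred slots) :
  (forall s i j, i \in A -> P (upd s i j) = P s) ->
  syz k A e a -> syz k A e (fun s => if P s then a s else 0).
Proof.
move=> PA [ha la ca]; split=> [s|s i iA|s i iA].
- by case: (P s) => //; apply: hlow0.
- by case: (P s); [exact: la | rewrite eqxx].
- rewrite /contract; under eq_bigr do rewrite PA //.
  case: (P s); first exact: ca.
  by rewrite big1 // => j _; rewrite mul0r.
Qed.

Lemma syz_weak (k : 'I_r) A e a : syz k.+1 A e a -> syz k A e a.
Proof.
move=> [ha la ca]; split=> [s|s i iA|//].
- exact: hlow_weak.
- by move=> /(la _ _ iA); rewrite mlowS => /andP[].
Qed.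

(* Slot [i] of [a] only contains multiples of ['X_k]; exchanging one factor
   ['X_k] of it with a factor ['X_l] of the coefficient kills the contraction
   of slot [i] and does not change the coefficient modulo ['X_k]. *)
Definition exchange (k l : 'I_r) i a s : S :=
  a s * 'X_l -
  (\sum_(j | (mon (s i) + U_(k) == mon j + U_(l))%MM) a (upd s i j)) * 'X_k.

(** In the contraction of slot [i] the terms cancel in pairs: if [x_k] divides [x^j], then
    [x_l x^j = x_k x^j'] for the monomial [x^j' = x^j x_l / x_k]. For a slot of [A] the operation
    commutes with the contraction, since it touches only slot [i] and the coefficient. *)
Lemma syz_exchange (k l : 'I_r) i A e a : (k < l)%N -> i \notin A ->
  (forall s, a s != 0 -> mlow k (mon (s i)) && (mon (s i) k != 0%N)) ->
  syz k A e a -> syz k (i |: A) e.+1 (exchange k l i a).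
Proof.
move=> lt_kl niA bad [ha la ca]; split=> [s|s i' i'A|s i'].
- apply: hlowD; first by apply: hlowMX => //; apply: ltnW.
  by apply/hlowN/hlowMX => //; apply: hlow_sum.
- move=> nz.
  have [as0|[j sj asj]] : a s != 0 \/ exists2 j,
      (mon (s i) + U_(k) == mon j + U_(l))%MM & a (upd s i j) != 0.
    have [as0|] := eqVneq (a s) 0; last by left.
    right; apply/exists_inP; apply: contraNT nz => /exists_inPn h.
    rewrite /exchange as0 mul0r big1 ?mul0r ?subr0 // => j /h.
    by rewrite negbK => /eqP.
  + move: i'A; rewrite in_setU1 => /orP[/eqP ->|/la -> //].
    by have /andP[] := bad s as0.
  + move: i'A; rewrite in_setU1 => /orP[/eqP ->|i'A].
      have /andP[+ _] := bad _ asj; rewrite updE eqxx => /mlowP lj.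
      apply/mlowP => x lt_xk; have /eqP/mnmP/(_ x) := sj.
      rewrite !mnmDE lj // !mnm1E.
      have /negbTE -> : l != x.
        by apply: contraTneq lt_kl => ->; rewrite -leqNgt ltnW.
      by move/eqP; rewrite addn_eq0 => /andP[/eqP].
    have := la _ _ i'A asj; rewrite updE; case: eqP => // i'i.
    by rewrite -i'i i'A in niA.
- rewrite in_setU1 => /predU1P[->|i'A]; rewrite /contract /exchange.
    under eq_bigr => j _.
      rewrite mulrBl updE eqxx; under eq_bigr do rewrite upd_id.
      rewrite !mulr_suml; over.
    rewrite sumrB [X in _ - X](exchange_big_dep predT) //= -sumrB.
    apply: big1 => j _.
    have [->|nz] := eqVneq (a (upd s i j)) 0.
      by rewrite !mul0r sub0r big1 ?oppr0 // => *; rewrite !mul0r.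
    have /andP[_] := bad _ nz; rewrite updE eqxx => jk.
    have le_kj : (U_(k) <= mon j + U_(l))%MM.
      apply/mnm_lepP => x; rewrite mnmDE mnm1E; case: eqP => // <-.
      by rewrite -(prednK (n := mon j k)) ?lt0n.
    have [j' j'E] : exists j', mon j' = (mon j + U_(l) - U_(k))%MM.
      apply: mon_surj; apply/eqP.
      rewrite -(eqn_add2r (mdeg (U_(k)%MM : 'X_{1..r}))) -mdegD submK //.
      by rewrite !mdegD !mdeg1 mdeg_mon.
    rewrite (big_pred1 j') => [|x]; last first.
      rewrite /pred1 /= -(inj_eq mon_inj) j'E.
      by rewrite -[RHS](eqm_add2r U_(k)%MM) submK.
    by rewrite -!mulrA -!mpolyXD j'E [(U_(k) + _)%MM]addmC submK // addmC subrr.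
  have nii' : i != i' by apply: contraNneq niA => ->.
  under eq_bigr => j _.
    rewrite updE (negbTE nii'); under eq_bigr do rewrite updC 1?eq_sym //.
    rewrite mulrBl mulrAC [_ * 'X_k * _]mulrAC mulr_suml; over.
  rewrite sumrB -!mulr_suml [X in X * _ - _](ca s i' i'A) mul0r sub0r.
  rewrite exchange_big /= big1 ?mul0r ?oppr0 // => j _.
  exact: ca.
Qed.

Lemma mtrunc_exchange (k l : 'I_r) i a s q :
  mtrunc k (exchange k l i a s * q) = mtrunc k (a s * 'X_l * q).
Proof.
rewrite /exchange mulrBl linearB /= [X in _ - mtrunc k X]mulrAC mtruncMX.
by rewrite mnm1E eqxx subr0.
Qed.

End Syzygies.

(** * Generation of syzygies by restriction to coordinate hyperplanes *)

Section Generation.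
Variables (K : fieldType) (r d : nat) (I : finType).
Local Notation S := {mpoly K[r]}.
Local Notation J := (monomials r d).
Local Notation slots := {ffun I -> J}.
Implicit Types (A B : {set I}) (a b : slots -> S).

(** The set [A] is quantified inside because the step from [k + 1] to [k] uses the property for
    smaller sets of slots. *)
Definition generated_from (k : nat) : Prop := forall A e a, (#|A| < e)%N ->
  syz k A e a -> exists b : 'I_r -> slots -> S,
    (forall l, syz k A e.-1 (b l)) /\
    forall s, a s = \sum_(l : 'I_r | (k <= l)%N) b l s * 'X_l.

Lemma mpolyX_neq0 (m : 'X_{1..r}) : 'X_[m] != 0 :> S.
Proof. by rewrite -msupp_eq0 msuppX. Qed.

Lemma syzN k A e a : syz k A e a -> syz k A e (fun s => - a s).
Proof.
move=> [ha la ca]; split=> [s|s i iA|s i iA].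
- exact: hlowN.
- by rewrite oppr_eq0; apply: la.
- rewrite /contract; under eq_bigr do rewrite mulNr.
  by rewrite sumrN [X in - X](ca s i iA) oppr0.
Qed.

Lemma syzMX k A e a (l : 'I_r) : (k <= l)%N -> syz k A e a ->
  syz k A e.+1 (fun s => a s * 'X_l).
Proof.
move=> le_kl [ha la ca]; split=> [s|s i iA|s i iA].
- exact: hlowMX.
- by rewrite mulf_eq0 (negbTE (mpolyX_neq0 _)) orbF; apply: la.
- rewrite /contract; under eq_bigr do rewrite mulrAC.
  by rewrite -mulr_suml [X in X * _](ca s i iA) mul0r.
Qed.

Lemma syzMX_inv k A e a (l : 'I_r) : syz k A e.+1 (fun s => a s * 'X_l) ->
  syz k A e a.
Proof.
move=> [ha la ca]; split=> [s|s i iA nz|s i iA].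
- exact: hlowMX_inv (ha s).
- by apply: la => //; rewrite mulf_eq0 negb_or nz mpolyX_neq0.
- apply: (mulIf (mpolyX_neq0 U_(l))); rewrite mul0r -(ca s i iA) mulr_suml.
  by apply: eq_bigr => j _; rewrite mulrAC.
Qed.

(** Induction on [B]. Expand [a] on the hyperplane as a combination of the [x_l] with [l > k], lift
    the coefficients for [B] minus a slot [i], then use the factor [x_l] just split off to exchange
    it against [x_k] in slot [i]. The exchange is invisible modulo [x_k]. Every slot of [B] consumes
    one degree, hence the bound on [#|A| + #|B|]. *)
Lemma syz_lift (k : 'I_r) : generated_from k.+1 -> forall B A e a,
  [disjoint A & B] -> (#|A| + #|B| < e)%N -> syz k.+1 A e a ->
  (forall s i, i \in B -> a s != 0 ->
     mlow k (mon (s i)) && (mon (s i) k != 0%N)) ->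
  exists b : 'I_r -> slots -> S, (forall l, syz k (A :|: B) e.-1 (b l)) /\
    forall s, mtrunc k (a s) = mtrunc k (\sum_(l : 'I_r | (k <= l)%N) b l s * 'X_l).
Proof.
move=> gen B; elim: {B}#|B| {-2}B (erefl #|B|) => [|N IH] B cardB A e a dAB.
  rewrite cardB addn0 => lt_Ae syz_a _.
  have B0 := cards0_eq cardB.
  have [b [syz_b aE]] := gen _ _ _ lt_Ae syz_a.
  exists (fun (l : 'I_r) s => if (k < l)%N then b l s else 0); split=> [l|s].
    rewrite B0 finset.setU0; apply: syz_cut => //; exact/syz_weak/syz_b.
  congr (mtrunc k _); rewrite aE big_mkcond [RHS]big_mkcond /=.
  apply: eq_bigr => l _; case: (ltnP k l) => [/ltnW -> //|le_lk].
  by rewrite mul0r if_same.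
have /card_gt0P[i iB] : (0 < #|B|)%N by rewrite cardB.
have cardB1 : #|B :\ i| = N by apply/eqP; rewrite (cardsD1 i) iB in cardB;
  rewrite -eqSS -cardB.
move=> lt_e syz_a bad.
have niA : i \notin A by apply: contraTN iB => iA; rewrite (disjointFr dAB).
have [b [syz_b aE]] := gen _ _ _ (leq_ltn_trans (leq_addr #|B| _) lt_e) syz_a.
pose isbad (s : slots) i' := mlow k (mon (s i')) && (mon (s i') k != 0%N).
(* The expansion need not respect the support condition on the slots of [B]. Cutting it down
   restores the condition for the recursive call and loses nothing, as [a] is supported there. *)
pose b1 l (s : slots) := if [forall i' in B, isbad s i'] then b l s else 0.
have syz_b1 l : syz k.+1 A e.-1 (b1 l).
  apply: syz_cut => // s i' j i'A; apply: eq_forallb => x.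
  case: (boolP (x \in B)) => //= xB; rewrite /isbad updE.
  by case: eqP => // x_i'; rewrite x_i' (disjointFr dAB) in xB.
have dAB1 : [disjoint A & B :\ i].
  by apply: disjointWr dAB; apply: finset.subD1set.
have lt_e1 : (#|A| + #|B :\ i| < e.-1)%N.
  by move: lt_e; rewrite cardB cardB1; case: (e) => // e'; rewrite addnS ltnS.
have e_gt1 : (1 < e)%N by case: (e) lt_e1 => [|[]].
have bad1 l s i' : i' \in B :\ i -> b1 l s != 0 ->
    mlow k (mon (s i')) && (mon (s i') k != 0%N).
  move=> i'B; rewrite /b1; case: ifP => [/forall_inP h _|_]; last by rewrite eqxx.
  by apply: h; move: i'B; rewrite !inE => /andP[].
have := fun l => IH _ cardB1 _ _ _ dAB1 lt_e1 (syz_b1 l) (bad1 l).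
move=> /choice[c hc].
(* The recursive call does not control slot [i], but the exchange needs [x_k] to divide it. *)
pose c1 l l' (s : slots) := if isbad s i then c l l' s else 0.
exists (fun l' s => \sum_(l : 'I_r | (k < l)%N) exchange k l i (c1 l l') s).
split=> [l'|s].
  apply: syz_sum => l lt_kl.
  have -> : A :|: B = i |: (A :|: B :\ i).
    by rewrite finset.setUCA finset.setD1K.
  have -> : e.-1 = e.-2.+1 by case: (e) e_gt1 => [|[]].
  apply: syz_exchange => //.
  - by rewrite !inE eqxx (negbTE niA).
  - by move=> s; rewrite /c1 /isbad; case: ifP => // _; rewrite eqxx.
  - apply: syz_cut; last by case: (hc l).
    move=> s i' j; rewrite !inE /isbad updE => h.
    by case: eqP => // ii'; move: h; rewrite -ii' eqxx (negbTE niA).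
transitivity (\sum_(l : 'I_r | (k < l)%N) mtrunc k (b1 l s) * 'X_l).
  have -> : a s = \sum_(l : 'I_r | (k < l)%N) b1 l s * 'X_l.
    rewrite /b1; case: (boolP [forall i' in B, isbad s i']); first by rewrite aE.
    move=> /forall_inPn[i' i'B nbad].
    rewrite big1 => [|l _]; last by rewrite mul0r.
    by apply/eqP; apply: contraNT nbad; apply: bad.
  rewrite linear_sum /=; apply: eq_bigr => l lt_kl.
  have /negbTE lk : l != k by apply: contraTneq lt_kl => ->; rewrite ltnn.
  by rewrite mtruncMX mnm1E lk.
under [in RHS]eq_bigr do rewrite mulr_suml.
rewrite exchange_big linear_sum /=; apply: eq_bigr => l lt_kl.
rewrite linear_sum /=.
under eq_bigr do rewrite mtrunc_exchange mulrAC.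
have /negbTE lk : l != k by apply: contraTneq lt_kl => ->; rewrite ltnn.
rewrite -linear_sum -mulr_suml /= mtruncMX mnm1E lk /=.
congr (_ * _); rewrite /c1; case: (boolP (isbad s i)) => [_|nbad]; first by case: (hc l).
rewrite big1 => [|l' _]; last by rewrite mul0r.
rewrite /b1 ifN //; apply/forall_inPn; exists i => //.
Qed.

(** Split the restriction of [a] to [x_k = 0] by the set [B] of slots whose monomial is divisible by
    [x_k]. The piece of [B] is a syzygy on the hyperplane in the slots of [A] outside [B], and
    [syz_lift] makes it one in all of [A]. The lifts add up to [a] modulo [x_k]. *)
Lemma generation_step (k : 'I_r) : generated_from k.+1 -> generated_from k.
Proof.
move=> gen A e a lt_Ae syz_a; have [ha la ca] := syz_a.
pose badset (s : slots) := [set i in A | ~~ mlow k.+1 (mon (s i))].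
pose aB B (s : slots) := if badset s == B then mtrunc k (a s) else 0.
have mtr0 s : mtrunc k (a s) != 0 -> a s != 0.
  by apply: contraNneq => ->; rewrite linear0.
have syz_aB B : B \subset A -> syz k.+1 (A :\: B) e (aB B).
  move=> sBA; split=> [s|s i|s i].
  - by rewrite /aB; case: ifP => _; [exact: hlow_mtrunc | exact: hlow0].
  - rewrite inE => /andP[niB iA]; rewrite /aB.
    case: ifP => [/eqP sB _|]; last by rewrite eqxx.
    by apply: contraNT niB => nlow; rewrite -sB inE iA.
  rewrite inE => /andP[niB iA].
  have [sB|nsB] := boolP [forall i' in A :\ i, (i' \in B) == ~~ mlow k.+1 (mon (s i'))]; last first.
    rewrite /contract big1 // => j _; rewrite /aB.
    case: eqP => [sB|_]; last by rewrite mul0r.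
    case/forall_inPn: nsB => i'; rewrite !inE => /andP[ii' i'A] /negP[].
    by rewrite -sB inE i'A updE (negbTE ii').
  (* Truncating the contraction of [a] kills the terms whose monomial in slot [i] is divisible by
     [x_k]. Since the other slots agree with [B], the surviving terms are exactly those with bad set
     [B]. *)
  transitivity (mtrunc k (contract a i s)); last by rewrite ca // linear0.
  rewrite linear_sum; apply: eq_bigr => j _ /=; rewrite mtruncMX /aB.
  have [z|nz] := eqVneq (mtrunc k (a (upd s i j))) 0.
    by rewrite z if_same mul0r if_same.
  have := la _ _ iA (mtr0 _ nz); rewrite updE eqxx => lj.
  have -> : (badset (upd s i j) == B) = (mon j k == 0%N).
    apply/eqP/idP => [E|jk].
      apply: contraNT niB => jk; rewrite -E inE iA updE eqxx mlowS.
      by rewrite (negbTE jk).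
    apply/setP => x; rewrite inE updE.
    have [->|xi] := eqVneq x i; first by rewrite iA mlowS jk lj (negbTE niB).
    have [xA|xA] := boolP (x \in A); last first.
      by apply/esym/negbTE; apply: contra xA; apply: (fintype.subsetP sBA).
    by apply/esym/eqP; apply: (forall_inP sB); rewrite !inE xi.
  by case: ifP => //; rewrite mul0r.
have bad B s i : i \in B -> aB B s != 0 ->
    mlow k (mon (s i)) && (mon (s i) k != 0%N).
  rewrite /aB; case: ifP => [/eqP <-|]; last by rewrite eqxx.
  rewrite inE => /andP[iA nlow] /mtr0/(la _ _ iA) lk; rewrite lk /=.
  by apply: contra nlow; rewrite mlowS => ->.
have cB B : exists c : 'I_r -> slots -> S, B \subset A ->
    (forall l, syz k A e.-1 (c l)) /\ forall s, mtrunc k (aB B s) =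
       mtrunc k (\sum_(l : 'I_r | (k <= l)%N) c l s * 'X_l).
  have [sBA|] := boolP (B \subset A); last by exists (fun _ _ => 0).
  have dAB : [disjoint A :\: B & B].
    by rewrite -finset.setI_eq0 finset.setIDAC finset.setDIl finset.setDv finset.setI0.
  have card_AB : (#|A :\: B| + #|B| = #|A|)%N.
    by rewrite addnC -[in RHS](cardsID B A) (finset.setIidPr sBA).
  rewrite -card_AB in lt_Ae.
  have [c [syz_c cE]] := syz_lift gen dAB lt_Ae (syz_aB _ sBA) (@bad B).
  exists c => _; split=> // l; have := syz_c l.
  by rewrite finset.setUC finset.setDE finset.setUIr finset.setUCr finset.setIT (finset.setUidPr sBA).
have [c hc] := choice cB.
pose b l s := \sum_(B : {set I} | B \subset A) c B l s.
have syz_b l : syz k A e.-1 (b l).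
  by apply: syz_sum => B sBA; have [] := hc _ sBA.
have trE s : mtrunc k (a s) = mtrunc k (\sum_(l : 'I_r | (k <= l)%N) b l s * 'X_l).
  transitivity (\sum_(B : {set I} | B \subset A) mtrunc k (aB B s)).
    rewrite (bigD1 (badset s)) /=; last by apply/fintype.subsetP => i;
      rewrite inE => /andP[].
    rewrite {1}/aB eqxx mtrunc_id big1 ?addr0 // => B /andP[_ sB].
    by rewrite /aB eq_sym (negbTE sB) linear0.
  rewrite linear_sum /=.
  under [in RHS]eq_bigr do rewrite /b mulr_suml linear_sum /=.
  rewrite exchange_big /=; apply: eq_bigr => B sBA.
  by have [_ ->] := hc _ sBA; rewrite linear_sum.
have q_ex s : exists c, a s - \sum_(l : 'I_r | (k <= l)%N) b l s * 'X_l = c * 'X_k.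
  by have [x xE] := mtrunc_eq (trE s); exists x.
have [q qE] := choice q_ex.
have e_gt0 : (0 < e)%N by apply: leq_ltn_trans lt_Ae.
(* [x_k] is not a zero divisor, so the quotient of the remainder by [x_k] is again a syzygy; it is
   absorbed into the coefficient of [x_k]. *)
have syz_q : syz k A e.-1 q.
  apply: (@syzMX_inv _ _ _ _ k); rewrite prednK //.
  have -> : (fun s => q s * 'X_k) = fun s =>
      a s + - \sum_(l : 'I_r | (k <= l)%N) b l s * 'X_l.
    by apply: funext => s; rewrite -qE.
  apply/syzD/syzN/syz_sum => // l le_kl.
  by rewrite -(prednK e_gt0); apply: syzMX.
exists (fun l s => b l s + if l == k then q s else 0); split=> [l|s].
  by apply: syzD => //; case: eqP => // _; apply: syz0.
have /eqP := qE s; rewrite subr_eq => /eqP ->; rewrite addrC.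
under [RHS]eq_bigr do rewrite mulrDl.
rewrite big_split /= [X in _ = _ + X](bigD1 k) //= eqxx.
by rewrite [X in _ + (_ + X)]big1 ?addr0 // => l /andP[_ /negbTE ->]; rewrite mul0r.
Qed.

(** No variables are left, so there are no nonzero coefficients in positive degree. *)
Lemma generation_top : generated_from r.
Proof.
move=> A e a lt_Ae [ha _ _]; exists (fun _ _ => 0); split=> [l|s].
  exact: syz0.
rewrite big1 => [|l _]; last by rewrite mul0r.
exact: hlow_last (leq_ltn_trans (leq0n _) lt_Ae) (ha s).
Qed.

Lemma generation : generated_from 0.
Proof.
have gen N : (N <= r)%N -> generated_from (r - N).
  elim: N => [_|N IH lt_Nr]; first by rewrite subn0; apply: generation_top.
  have lt_k : (r - N.+1 < r)%N by rewrite ltn_subrL (leq_ltn_trans _ lt_Nr).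
  apply: (@generation_step (Ordinal lt_k)) => /=.
  by rewrite subnSK //; apply: IH; apply: ltnW.
by rewrite -(subnn r); apply: gen.
Qed.

Lemma syz_multiples A e D a : (#|A| <= e)%N -> syz 0 A (e + D) a ->
  exists (L : finType) (m : L -> 'X_{1..r}) (b : L -> slots -> S),
    [/\ forall x, mdeg (m x) = D, forall x, syz 0 A e (b x)
      & forall s, a s = \sum_x b x s * 'X_[m x]].
Proof.
elim: D e a => [|D IH] e a le_Ae.
  rewrite addn0 => syz_a.
  exists 'I_1, (fun=> 0%MM), (fun=> a); split=> [_|//|s]; first exact: mdeg0.
  by rewrite big_ord1 mpolyX0 mulr1.
rewrite -addSnnS => /(IH _ _ (leqW le_Ae))[L [m [b [md syz_b aE]]]].
have /choice[c hc] := fun x => generation (le_Ae : (#|A| < e.+1)%N) (syz_b x).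
exists (L * 'I_r)%type, (fun x => m x.1 + U_(x.2))%MM, (fun x => c x.1 x.2).
split=> [x|x|s].
- by rewrite mdegD mdeg1 md addn1.
- by have [h _] := hc x.1.
rewrite aE -(pair_bigA _ (fun x l => c x l s * 'X_[m x + U_(l)])) /=.
apply: eq_bigr => x _; have [_ ->] := hc x; rewrite mulr_suml.
by apply: eq_bigr => l _; rewrite addmC mpolyXD mulrA.
Qed.

(* Castelnuovo-Mumford regularity of the kernel bundle of [O(d)] in disguise:
   its [p]-th tensor power is [p]-regular. *)
Lemma syz_monomials A e a : (#|A| <= e)%N -> syz 0 A (e + d) a ->
  exists b : J -> slots -> S, (forall j, syz 0 A e (b j)) /\
    forall s, a s = \sum_j b j s * 'X_[mon j].
Proof.
move=> le_Ae /(syz_multiples le_Ae)[L [m [b [md syz_b aE]]]].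
exists (fun j s => \sum_(x | mon j == m x) b x s); split=> [j|s].
  exact: syz_sum.
under eq_bigr do rewrite mulr_suml.
rewrite (exchange_big_dep predT) //= aE; apply: eq_bigr => x _.
have [j jE] := mon_surj (md x).
rewrite (big_pred1 j) ?jE // => j' /=.
by rewrite -jE (inj_eq (@mon_inj _ _)).
Qed.

End Generation.

(** * The Nullstellensatz over an uncountable field *)

Section Uncountable.

(** Cut the interval into thirds: a point lies in at most one of the two outer ones, so the other
    avoids it. *)
Lemma avoid_seq (R : realFieldType) (s : seq R) (a b : R) : a < b ->
  exists ab : R * R, [/\ a <= ab.1, ab.1 < ab.2, ab.2 <= b
    & forall x, x \in s -> ~~ (ab.1 <= x <= ab.2)].
Proof.
move=> lt_ab; elim: s => [|y s [[a' b'] /= [le_a lt' le_b nin]]].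
  by exists (a, b).
have lt3 : a' < (a' *+ 2 + b') / 3%:R /\ (a' *+ 2 + b') / 3%:R < (a' + b' *+ 2) / 3%:R
    /\ (a' + b' *+ 2) / 3%:R < b' by split; [|split]; lra.
move: lt3; set c := _ / _; set e := _ / _ => -[lt_ac [lt_ce lt_eb]].
have [le_yc|lt_cy] := lerP y c.
  exists (e, b'); split=> //=.
  - by rewrite (le_trans le_a) // ltW // (lt_trans lt_ac).
  - move=> x; rewrite in_cons => /predU1P[->|/nin].
      by rewrite lt_geF ?(le_lt_trans le_yc).
    by apply: contra => /andP[le_ex ->]; rewrite (le_trans _ le_ex) ?ltW //;
      apply: lt_trans lt_ce.
exists (a', c); split=> //=.
- by rewrite (le_trans _ le_b) // ltW // (lt_trans lt_ce).
- move=> x; rewrite in_cons => /predU1P[->|/nin].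
    by rewrite [y <= c]lt_geF // andbF.
  apply: contra => /andP[-> le_xc] /=; rewrite (le_trans le_xc) // ltW //.
  exact: lt_trans lt_eb.
Qed.

(** Phrased as the existence of an infinite fibre, in the form that linear algebra uses: as many
    elements as wanted with the same value. *)
Definition not_countable (T : choiceType) : Prop := forall f : T -> nat,
  exists N, forall D, exists s : seq T,
    [/\ uniq s, size s = D & forall x, x \in s -> f x = N].

Lemma not_countableI (T : choiceType) : (forall f : T -> nat,
    ~ exists s : nat -> seq T, forall x, x \in s (f x)) -> not_countable T.
Proof.
move=> H f; apply: contrapT => none; apply: (H f).
have /choice[s sP] : forall N, exists s : seq T, forall x, f x = N -> x \in s.
  move=> N; apply: contrapT => nos; apply: none; exists N.
  elim=> [|D [s [uniq_s size_s sN]]]; first by exists [::].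
  have [x [fx xs]] : exists x, f x = N /\ x \notin s.
    apply: contrapT => nox; apply: nos; exists s => x fx.
    by apply: contrapT => /negP xs; apply: nox; exists x.
  exists (x :: s); split=> /=; rewrite ?xs ?size_s // => y.
  by rewrite in_cons => /predU1P[->|/sN].
by exists s => x; apply: sP.
Qed.

(** Nested intervals: [u n.+1] avoids a finite list containing the fibre of [f] over [n], so a point
    [x] of all the intervals would be missing from its own fibre over [f x]. *)
Lemma real_not_countable (R : realType) : not_countable R.
Proof.
apply: not_countableI => f [s sP].
have /choice[nxt nxtP] : forall Nab : nat * (R * R), exists ab : R * R,
    Nab.2.1 < Nab.2.2 -> [/\ Nab.2.1 <= ab.1, ab.1 < ab.2, ab.2 <= Nab.2.2
      & forall x, x \in s Nab.1 -> ~~ (ab.1 <= x <= ab.2)].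
  move=> [N [a b]] /=; have [lt_ab|] := boolP (a < b); last by exists (0, 0).
  by have [ab h] := avoid_seq (s N) lt_ab; exists ab.
pose u := fix u n : R * R := if n is n'.+1 then nxt (n', u n') else (0, 1).
have u_lt n : (u n).1 < (u n).2.
  by elim: n => [|n IH] /=; rewrite ?ltr01 //; have [] := nxtP (n, u n) IH.
have uP n := nxtP (n, u n) (u_lt n).
have mono n m : (u n).1 <= (u (n + m)%N).1 /\ (u (n + m)%N).2 <= (u n).2.
  elim: m => [|m [IH1 IH2]]; first by rewrite addn0.
  rewrite addnS; have /= [h1 _ h2 _] := uP (n + m)%N.
  by split; [exact: le_trans h1 | exact: le_trans IH2].
have le_u n m : (u n).1 <= (u m).2.
  have [h1 _] := mono n m; have [_ h2] := mono m n.
  apply: le_trans h1 _; apply: le_trans (ltW (u_lt _)) _.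
  by rewrite addnC.
pose A : set R := fun x => exists n, x = (u n).1.
have A0 : nonempty A by exists (u 0).1; exists 0%N.
have ubA n : ubound A (u n).2 by move=> _ [m ->].
have supA : has_sup A by split=> //; exists (u 0).2.
pose x := sup A.
have x_in n : (u n).1 <= x <= (u n).2.
  apply/andP; split; first by apply: sup_upper_bound => //; exists n.
  exact: ge_sup.
have /= [_ _ _ /(_ x)] := uP (f x).
by rewrite sP => /(_ isT); rewrite (x_in (f x).+1).
Qed.

Lemma complex_not_countable (R : realType) : not_countable R[i].
Proof.
move=> f; have [N hN] := real_not_countable (fun x => f x%:C%C).
exists N => D; have [s [us ss sN]] := hN D.
exists [seq x%:C%C | x <- s]; split; last 1 first.
- by move=> _ /mapP[x /sN <- ->].
- by rewrite map_inj_uniq // => x y [].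
- by rewrite size_map.
Qed.

End Uncountable.

Section Nullstellensatz.
Variables (K : closedFieldType) (r : nat).
Hypothesis K_nc : not_countable K.
Local Notation S := {mpoly K[r]}.
Implicit Types (I : S -> Prop) (f g h u : S).

Definition ideal_of I : Prop :=
  [/\ I 0, forall f g, I f -> I g -> I (f + g) & forall h f, I f -> I (h * f)].

Lemma ideal_sum I (T : Type) (s : seq T) (P : pred T) (F : T -> S) :
  ideal_of I -> (forall x, P x -> I (F x)) -> I (\sum_(x <- s | P x) F x).
Proof. by move=> [I0 ID _] IF; elim/big_ind: _. Qed.

(* If all [h - c] were invertible modulo [I], uncountably many of the inverses
   would have bounded degree, and a linear relation between them would make
   [h] algebraic modulo [I]. *)
Lemma ideal_shift I h : ideal_of I -> ~ I 1 ->
  exists c : K, forall u, ~ I (1 - u * (h - c%:MP)).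
Proof.
move=> idI I1; have [I0 ID IM] := idI; apply: contrapT => noc.
have /choice[u uP] : forall c : K, exists u, I (1 - u * (h - c%:MP)).
  by move=> c; apply: contrapT => nou; apply: noc; exists c => u Iu; apply: nou; exists u.
(* Modulo [I] the element [h - c] has the inverse [u c], so it can be cancelled. *)
have cancelI c g : I (g * (h - c%:MP)) -> I g.
  move=> Ig; rewrite (_ : g = g * (1 - u c * (h - c%:MP)) + u c * (g * (h - c%:MP))).
    by apply: ID; apply: IM.
  by ring.
(* Polynomials of size [N] live in a space whose dimension is the number of monomials of degree less
   than [N]; one more inverse than that forces a linear relation [v]. *)
have [N /(_ #|{: 'X_{1..r < N}}|.+1)] := K_nc (fun c => msize (u c)).
set D := #|_| => -[s [us size_s sN]].
pose A : 'M[K]_(D.+1, D) := \matrix_(i < D.+1, j < D)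
  (u s`_i)@_(enum_val (j : 'I_#|{: 'X_{1..r < N}}|)).
have : kermx A != 0.
  rewrite kermx_eq0 /row_free neq_ltn; apply/orP; left.
  by rewrite ltnS rank_leq_col.
case/rowV0Pn => v /sub_kermxP vA v0.
have s_in (i : 'I_D.+1) : s`_i \in s by rewrite mem_nth ?size_s.
have rel : \sum_i v 0 i *: u s`_i = 0.
  apply/mpolyP => m; rewrite mcoeff0 raddf_sum /=.
  have [lt_m|le_m] := ltnP (mdeg m) N; last first.
    apply: big1 => i _; rewrite mcoeffZ memN_msupp_eq0 ?mulr0 //.
    by apply: msize_mdeg_ge; rewrite (sN s`_i).
  have := congr1 (fun B : 'rV[K]_D => B 0 (enum_rank (BMultinom lt_m))) vA.
  rewrite [LHS]mxE [RHS]mxE => E; rewrite -[RHS]E; apply: eq_bigr => i _.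
  by rewrite !mxE enum_rankK mcoeffZ.
(* The relation between the inverses of the [h - s_i], cleared of denominators. Its value at [s_i]
   is [v_i] times a nonzero product, so it is a nonzero polynomial. *)
pose P : {poly K} :=
  \sum_i v 0 i *: \prod_(j < D.+1 | j != i) ('X - (s`_j)%:P).
have P0 : P != 0.
  have /existsP[i vi] : [exists i, v 0 i != 0].
    apply: contraNT v0 => /existsPn v0; apply/eqP/rowP => i; rewrite mxE.
    by apply/eqP; rewrite -[_ == _]negbK v0.
  apply: contra_neq vi => /(congr1 (horner^~ s`_i)).
  rewrite horner0 horner_sum (bigD1 i) //= [X in _ + X]big1 => [|j ji].
    rewrite addr0 hornerZ horner_prod => /eqP; rewrite mulf_eq0 => /orP[/eqP //|].
    rewrite prodf_seq_eq0 => /hasP[j _ /andP[ji]].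
    rewrite !hornerE subr_eq0 nth_uniq ?size_s // => /eqP/val_inj ij.
    by rewrite ij eqxx in ji.
  by rewrite hornerZ horner_prod (bigD1 i) 1?eq_sym //= hornerXsubC subrr mul0r mulr0.
pose phi (q : {poly K}) : S := horner_alg h q.
have phiXsub c : phi ('X - c%:P) = h - c%:MP.
  by rewrite /phi rmorphB /= horner_algX horner_algC alg_mpolyC.
have IP : I (phi P).
  pose W (i : 'I_D.+1) : S := \prod_(j < D.+1 | j != i) (h - (s`_j)%:MP).
  have -> : phi P = \sum_i (v 0 i *: W i) * (1 - u s`_i * (h - (s`_i)%:MP)).
    transitivity (\sum_i v 0 i *: W i).
      rewrite /phi linear_sum; apply: eq_bigr => i _ /=.
      rewrite linearZ /= rmorph_prod mulr_algl; congr (_ *: _).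
      by apply: eq_bigr => j _; apply: phiXsub.
    apply/eqP; rewrite -subr_eq0 -sumrB; apply/eqP.
    transitivity ((\sum_i v 0 i *: u s`_i) * \prod_(j < D.+1) (h - (s`_j)%:MP)).
      rewrite mulr_suml; apply: eq_bigr => i _.
      by rewrite [in RHS](bigD1 i) //= -/(W i) -!mul_mpolyC; ring.
    by rewrite rel mul0r.
  by apply: ideal_sum => // i _; apply: IM; apply: uP.
have [t Pt] := closed_field_poly_normal P.
suff : I (lead_coef P)%:MP.
  move=> IlcP; apply: I1.
  rewrite -(mpolyC1 r) -(mulVf (x := lead_coef P)) ?lead_coef_eq0 // rmorphM /=.
  exact: IM.
have PE : phi P = (lead_coef P)%:MP * \prod_(c <- t) (h - c%:MP).
  rewrite [in LHS]Pt /phi linearZ /= rmorph_prod mulr_algl mul_mpolyC.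
  by congr (_ *: _); apply: eq_bigr => c _; apply: phiXsub.
move: IP; rewrite PE.
elim: t {Pt PE} => [|c t IH]; first by rewrite big_nil mulr1.
by rewrite big_cons mulrCA mulrC => /cancelI.
Qed.

(** Enlarge [I] by some [X_i - x_i] for one variable after another, keeping it proper by
    [ideal_shift]. In the end every [f] is congruent to the constant [f(x)], and a nonzero constant
    in the ideal would make it the unit ideal. *)
Lemma nullstellensatz I : ideal_of I -> ~ I 1 ->
  exists x : 'I_r -> K, forall f, I f -> f.@[x] = 0.
Proof.
move=> idI I1.
have [x [I' [idI' I'1 sII' I'x]]] : exists (x : 'I_r -> K) I',
    [/\ ideal_of I', ~ I' 1, forall f, I f -> I' f
      & forall i, i \in enum 'I_r -> I' ('X_i - (x i)%:MP)].
  elim: (enum 'I_r) (enum_uniq 'I_r) => [_|i s IH /= /andP[nis /IH]].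
    by exists (fun=> 0), I.
  move=> [x [I' [idI' I'1 sII' I'x]]].
  have [c cP] := ideal_shift 'X_i idI' I'1.
  have [I'0 I'D I'M] := idI'.
  exists (fun j => if j == i then c else x j).
  exists (fun f => exists u, I' (f - u * ('X_i - c%:MP))); split.
  - split.
    + by exists 0; rewrite mul0r subrr.
    + move=> f g [u fu] [v gv]; exists (u + v).
      rewrite (_ : f + g - _ = (f - u * ('X_i - c%:MP)) + (g - v * ('X_i - c%:MP))).
        exact: I'D.
      by ring.
    + move=> h f [u fu]; exists (h * u); rewrite -mulrA -mulrBr; exact: I'M.
  - by case=> u /cP.
  - by move=> f /sII' If; exists 0; rewrite mul0r subr0.
  - move=> j; rewrite in_cons => /predU1P[->|js].
      by rewrite eqxx; exists 1; rewrite mul1r subrr.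
    by case: eqP => [ji|_]; [rewrite -ji js in nis | exists 0; rewrite mul0r subr0;
      apply: I'x].
have [I'0 I'D I'M] := idI'.
have {}I'x i : I' ('X_i - (x i)%:MP) by apply: I'x; rewrite mem_enum.
have modC c : I' (c%:MP - (c%:MP.@[x])%:MP) by rewrite mevalC subrr.
have modM f g : I' (f - (f.@[x])%:MP) -> I' (g - (g.@[x])%:MP) ->
    I' (f * g - ((f * g).@[x])%:MP).
  move=> If Ig; rewrite (_ : _ - _ =
      f * (g - (g.@[x])%:MP) + (g.@[x])%:MP * (f - (f.@[x])%:MP)).
    by apply: I'D; apply: I'M.
  by rewrite mevalM mpolyCM; ring.
have modX m : I' ('X_[m] - ('X_[K, m].@[x])%:MP).
  rewrite mpolyXE_id; elim/big_ind: _ => [|f g|i _]; [exact: (modC 1)|exact: modM|].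
  elim: (m i) => [|k IH]; first by rewrite expr0; apply: (modC 1).
  by rewrite exprS; apply: modM => //; rewrite mevalXU.
exists x => f If; apply/eqP/negP => /negP fx.
have modf : I' (f - (f.@[x])%:MP).
  elim/mpolyind: f {If fx} => [|c m p _ _ IH]; first by rewrite meval0 mpolyC0 subrr.
  rewrite mevalD mpolyCD opprD addrACA -mul_mpolyC; apply: I'D => //.
  exact: modM.
apply: I'1; rewrite -(mpolyC1 r) -(mulVf fx) mpolyCM; apply: (I'M).
have -> : (f.@[x])%:MP = f + -1 * (f - (f.@[x])%:MP) by ring.
by apply: I'D; [exact: sII' | exact: I'M].
Qed.

End Nullstellensatz.

(** * Polynomials vanishing on a smooth hypersurface *)

Section LastVariable.
Variables (K : idomainType) (n : nat).

Definition of_muni : {poly {mpoly K[n]}} -> {mpoly K[n.+1]} :=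
  horner_eval 'X_ord_max \o map_poly (@mwiden n K).

HB.instance Definition _ := GRing.RMorphism.copy of_muni
  (horner_eval 'X_ord_max \o map_poly (@mwiden n K)).

Lemma of_muniM : {morph of_muni : p q / p * q}.
Proof. exact: rmorphM. Qed.

Lemma of_muniD : {morph of_muni : p q / p + q}.
Proof. exact: rmorphD. Qed.

Lemma of_muniC c : of_muni c%:P = mwiden c.
Proof. by rewrite /of_muni /= map_polyC /= horner_evalE hornerC. Qed.

Lemma of_muniZ c q : of_muni (c *: q) = mwiden c * of_muni q.
Proof. by rewrite -mul_polyC of_muniM of_muniC. Qed.

Lemma of_muniX : of_muni 'X = 'X_ord_max.
Proof. by rewrite /of_muni /= map_polyX horner_evalE hornerX. Qed.

Lemma muniX (m : 'X_{1..n.+1}) : muni 'X_[K, m] =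
  'X_[[multinom m (widen_ord (leqnSn n) i) | i < n]] *: 'X^(m ord_max).
Proof. by rewrite muniE msuppX big_seq1 mcoeffX eqxx scale1r. Qed.

Lemma muniK : cancel (@muni n K) of_muni.
Proof.
elim/mpolyind => [|c m p _ _ IH]; first by rewrite muni0 rmorph0.
rewrite muniD of_muniD [X in _ + X]IH muniZ muniX !of_muniZ.
have -> k : of_muni 'X^k = 'X_ord_max ^+ k by rewrite rmorphXn /= of_muniX.
rewrite mwidenC mul_mpolyC; congr (_ *: _ + _).
rewrite mwidenX mpolyXn -mpolyXD; congr 'X_[_]; apply/mnmP => i.
rewrite mnmDE mulmnE mnm1E; case: (unliftP ord_max i) => [j ->|->].
  have -> : fintype.lift ord_max j = widen_ord (leqnSn n) j.
    by apply: val_inj; rewrite /= /bump leqNgt ltn_ord.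
  rewrite mnmwiden_widen mnmE; case: eqP => [|_]; last by rewrite mul0n addn0.
  by move/(congr1 val) => /= nj; have := ltn_ord j; rewrite -nj ltnn.
by rewrite mnmwiden_ordmax eqxx mul1n.
Qed.

Lemma meval_mwiden (y : 'I_n.+1 -> K) p :
  (mwiden p).@[y] = p.@[y \o widen_ord (leqnSn n)].
Proof.
elim/mpolyind: p => [|c m p _ _ IH]; first by rewrite mwiden0 !meval0.
rewrite mwidenD !mevalD IH mwidenZ !mevalZ mwidenX !mevalX; congr (_ * _ + _).
rewrite big_ord_recr /= mnmwiden_ordmax expr0 mulr1.
by apply: eq_bigr => i _; rewrite mnmwiden_widen.
Qed.

Lemma meval_of_muni (y : 'I_n.+1 -> K) q :
  (of_muni q).@[y] =
  (map_poly (meval (y \o widen_ord (leqnSn n))) q).[y ord_max].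
Proof.
rewrite /of_muni /= horner_evalE -horner_map /= mevalXU -map_poly_comp.
by congr (_.[_]); apply: eq_map_poly => p /=; rewrite meval_mwiden.
Qed.

Definition extend (u : 'I_n -> K) (t : K) (i : 'I_n.+1) : K :=
  if unlift ord_max i is Some j then u j else t.

Lemma extend_widen u t : extend u t \o widen_ord (leqnSn n) = u.
Proof.
apply: funext => j; rewrite /extend /=.
have -> : widen_ord (leqnSn n) j = fintype.lift ord_max j.
  by apply: val_inj; rewrite /= /bump leqNgt ltn_ord.
by rewrite liftK.
Qed.

Lemma extend_max u t : extend u t ord_max = t.
Proof. by rewrite /extend unlift_none. Qed.

Lemma meval_of_muni_extend u t q :
  (of_muni q).@[extend u t] = (map_poly (meval u) q).[t].
Proof. by rewrite meval_of_muni extend_widen extend_max. Qed.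

End LastVariable.

Lemma poly_nonroot (K : numFieldType) (q : {poly K}) :
  q != 0 -> exists t, q.[t] != 0.
Proof.
move=> q0; apply: contrapT => noroot.
have : all (root q) [seq i%:R | i <- iota 0 (size q)].
  apply/allP => t _; apply/rootP/eqP/negP => /negP qt.
  by apply: noroot; exists t.
move/(max_poly_roots q0); rewrite map_inj_uniq ?iota_uniq;
  last exact: mulrIn (oner_neq0 _).
by move=> /(_ isT); rewrite size_map size_iota ltnn.
Qed.

Lemma mpoly_nonroot (K : numFieldType) (n : nat) (p : {mpoly K[n]}) :
  p != 0 -> exists u, p.@[u] != 0.
Proof.
elim: n p => [|n IH] p p0.
  exists (fun=> 0); rewrite -[p]mpolyKC mevalC.
  by apply: contraNneq p0 => p00; rewrite -[p]mpolyKC p00 mpolyC0.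
have q0 : muni p != 0 by apply: contra_neq p0 => E; rewrite -[p]muniK E rmorph0.
have [u qu] := IH (lead_coef (muni p)) (negbT (etrans (lead_coef_eq0 _) (negbTE q0))).
have : map_poly (meval u) (muni p) != 0.
  apply: contra_neq qu => /(congr1 (fun q : {poly K} => q`_(size (muni p)).-1)).
  by rewrite coef_map coef0.
move/poly_nonroot => [t qt]; exists (extend u t).
by rewrite -[p]muniK meval_of_muni_extend.
Qed.

Section SmoothHypersurface.
Variables (K : numClosedFieldType) (n : nat) (F : {mpoly K[n.+2]}).
Hypothesis F_smooth : smooth_hypersurface F.

Definition vanishes (P : {mpoly K[n.+2]}) : Prop :=
  forall y : cone F, P.@[sval y] = 0.

(* Take [p] nonzero of minimal degree in the last variable. Pseudo-division
   gives [c * F = q * p], where [p] vanishes at all zeros of [F]; at a common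
   zero of [q] and [F] outside [c = 0], the gradient of [F] is zero. *)
Lemma vanishes_size (p : {poly {mpoly K[n.+1]}}) :
  (size p < size (muni F))%N -> vanishes (of_muni p) -> p = 0.
Proof.
elim: (size p) {-2}p (leqnn (size p)) => [|N IH] {}p.
  by rewrite size_poly_leq0 => /eqP.
move=> le_pN lt_pF van_p; apply/eqP/negP => /negP p0.
have := Pdiv.Idomain.divp_eq (muni F) p.
have lt_mod : (size (muni F %% p)%R < size p)%N by rewrite ltn_modp.
set c := _ ^+ _; set q := _ %/ _ => divE.
have c0 : c != 0 by rewrite expf_neq0 // lead_coef_eq0.
have van_mod : vanishes (of_muni (muni F %% p)).
  move=> y; have : mwiden c * F = of_muni q * of_muni p + of_muni (muni F %% p).
    by rewrite -of_muniM -of_muniD -divE of_muniZ (muniK F).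
  move/(congr1 (meval (sval y))); rewrite mevalD !mevalM van_p mulr0 add0r => <-.
  by case: y {van_p} => y [_ Fy] /=; rewrite Fy mulr0.
have mod0 : muni F %% p = 0.
  by apply: IH => //; [rewrite -ltnS (leq_trans lt_mod) | apply: ltn_trans lt_pF].
rewrite mod0 addr0 in divE.
have F0 : muni F != 0 by rewrite -size_poly_gt0 (leq_ltn_trans _ lt_pF).
have q0 : q != 0.
  apply: contra_neq F0 => q0; have := size_scale (muni F) c0.
  by rewrite divE q0 mul0r size_poly0 => /esym/eqP; rewrite size_poly_eq0 => /eqP.
have size_q : (1 < size q)%N.
  have := congr1 (fun P : {poly _} => size P) divE.
  rewrite size_scale // size_mul // => sz.
  by move: lt_pF; rewrite sz; move: (size q) (size p) => a b; lia.
(* [c] must not vanish so that [F] does, the leading coefficient of [q] must not vanish so that [q]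
   keeps its degree and has a root over [u], and the factor [X_0] makes the resulting point
   nonzero. *)
have [u] : exists u, (c * lead_coef q * 'X_ord0).@[u] != 0.
  by apply: mpoly_nonroot; rewrite !mulf_neq0 ?lead_coef_eq0 // -msupp_eq0 msuppX.
rewrite !mevalM mevalXU !mulf_eq0 !negb_or => /andP[/andP[cu qu] u0].
have [t qt] : exists t, root (map_poly (meval u) q) t.
  by apply/closed_rootP; rewrite size_map_poly_id0 // neq_ltn size_q orbT.
pose y0 := extend u t.
have qy : (of_muni q).@[y0] = 0 by rewrite meval_of_muni_extend; apply/rootP.
have cF : mwiden c * F = of_muni q * of_muni p.
  by rewrite -of_muniM -divE of_muniZ (muniK F).
have cy : (mwiden c).@[y0] != 0 by rewrite meval_mwiden extend_widen.
have Fy : F.@[y0] = 0.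
  apply/eqP; have /(congr1 (meval y0)) := cF.
  by rewrite !mevalM qy mul0r => /eqP; rewrite mulf_eq0 (negbTE cy).
have y0P : (exists i, y0 i != 0) /\ F.@[y0] = 0.
  split=> //; exists (widen_ord (leqnSn _) ord0).
  by rewrite -[y0 _]/((y0 \o _) ord0) extend_widen.
have py : (of_muni p).@[y0] = 0 := van_p (exist _ y0 y0P).
case: (F_smooth (exist _ y0 y0P)) => i /=; apply/negP; rewrite negbK.
(* By the Leibniz rule at [y0], where [F], [p] and [q] all vanish, only [c] times the derivative of
   [F] survives. *)
have /(congr1 (fun P => (mderiv i P).@[y0])) := cF.
rewrite !mderivM !mevalD !mevalM Fy qy py !(mulr0, mul0r) add0r addr0 => /eqP.
by rewrite mulf_eq0 (negbTE cy).
Qed.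

End SmoothHypersurface.

Lemma meval_homogZ (K : fieldType) (n i : nat) (P : {mpoly K[n]}) (c : K) y :
  P \is i.-homog -> P.@[fun j => c * y j] = c ^+ i * P.@[y].
Proof.
move=> hP; rewrite !mevalE mulr_sumr; apply: eq_big_seq => m m_P.
rewrite mulrCA; congr (_ * _).
under eq_bigr do rewrite exprMn.
rewrite big_split /=; congr (_ * _).
by rewrite prodrXr -mdegE (dhomogP _ _ _ hP).
Qed.

Lemma mcoeff_muni (K : idomainType) (n : nat) (P : {mpoly K[n.+1]}) i m :
  (muni P)`_i@_m = P@_(mnmwiden m + U_(ord_max) *+ i).
Proof.
elim/mpolyind: P => [|c l P _ _ IH]; first by rewrite muni0 coef0 !mcoeff0.
rewrite muniD coefD !mcoeffD [X in _ + X = _]IH muniZ muniX coefZ mcoeffCM coefZ coefXn.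
rewrite mcoeffZ mcoeffX; congr (_ * _ + _).
have -> : (l == mnmwiden m + U_(ord_max) *+ i)%MM =
    ([multinom l (widen_ord (leqnSn n) j) | j < n] == m) && (i == l ord_max).
  apply/eqP/andP => [->|[/eqP <- /eqP ->]].
    split; last by rewrite mnmDE mnmwiden_ordmax mulmnE mnm1E eqxx mul1n.
    apply/eqP/mnmP => j; rewrite mnmE mnmDE mnmwiden_widen mulmnE mnm1E.
    case: eqP => [/(congr1 val) /= nj|_]; last by rewrite mul0n addn0.
    by have := ltn_ord j; rewrite -nj ltnn.
  apply/mnmP => x; rewrite mnmDE mulmnE mnm1E.
  case: (unliftP ord_max x) => [j ->|->].
    have -> : fintype.lift ord_max j = widen_ord (leqnSn n) j.
      by apply: val_inj; rewrite /= /bump leqNgt ltn_ord.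
    rewrite mnmwiden_widen mnmE; case: eqP => [/(congr1 val) /= nj|_].
      by have := ltn_ord j; rewrite -nj ltnn.
    by rewrite mul0n addn0.
  by rewrite mnmwiden_ordmax eqxx mul1n.
case: (i == _); rewrite ?andbT ?andbF ?mulr0 ?mcoeff0 //.
by rewrite mulr1 mcoeffX.
Qed.

(** * Normal forms modulo [F] *)

Section ReducedForms.
Variables (K : numClosedFieldType) (n e : nat) (F : {mpoly K[n.+2]}).
Hypotheses (F_homog : F \is e.-homog) (F_smooth : smooth_hypersurface F).
Local Notation t := (ord_max : 'I_n.+2).
Hypothesis F_top : F@_(U_(t) *+ e) != 0.
Local Notation S := {mpoly K[n.+2]}.
Implicit Types (P Q : S) (m l : 'X_{1..n.+2}).

(** Remainders of division by [F] with respect to [x_t]: by [F_top], [F] has degree [e] in [x_t]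
    with constant leading coefficient. *)
Definition low P : Prop := forall m, m \in msupp P -> (m t < e)%N.

Lemma low0 : low 0.
Proof. by move=> m; rewrite msupp0. Qed.

Lemma lowD P Q : low P -> low Q -> low (P + Q).
Proof. by move=> hP hQ m /msuppD_le; rewrite mem_cat => /orP[/hP|/hQ]. Qed.

Lemma lowN P : low P -> low (- P).
Proof. by move=> hP m; rewrite (perm_mem (msuppN P)); apply: hP. Qed.

Lemma lowZ c P : low P -> low (c *: P).
Proof. by move=> hP m /msuppZ_le; apply: hP. Qed.

Lemma low_mulXn P i N : i != t -> low P -> low (P * 'X_i ^+ N).
Proof.
move=> /negbTE it hP m; rewrite mpolyXn (perm_mem (msuppMX _ _)) => /mapP[l /hP lt ->].
by rewrite mnmDE mulmnE mnm1E it.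
Qed.

Lemma low_vanishes P : low P -> vanishes F P -> P = 0.
Proof.
move=> lowP vanP; have hs : vanishes F (of_muni (muni P)) by rewrite (muniK P).
rewrite -[P]muniK (vanishes_size F_smooth _ hs) ?rmorph0 //.
apply: (@leq_ltn_trans e).
  apply/leq_sizeP => i le_ei; apply/mpolyP => m; rewrite mcoeff_muni mcoeff0.
  apply/memN_msupp_eq0/negP => /lowP.
  by rewrite mnmDE mnmwiden_ordmax mulmnE mnm1E eqxx mul1n add0n ltnNge le_ei.
rewrite ltnNge; apply/negP => /leq_sizeP/(_ e (leqnn e)).
move/(congr1 (mcoeff 0%MM)); rewrite mcoeff_muni mcoeff0 mnmwiden0 add0m.
by move/eqP; rewrite (negbTE F_top).
Qed.

Lemma not_top m : mdeg m = e -> m != (U_(t) *+ e)%MM ->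
  (m t < e)%N /\ exists2 i, i != t & m i != 0%N.
Proof.
move=> md nm.
have [i it mi] : exists2 i, i != t & m i != 0%N.
  apply/exists_inP; apply: contraNT nm => /exists_inPn mi.
  have m0 i : i != t -> m i = 0%N by move=> /mi; rewrite negbK => /eqP.
  apply/eqP/mnmP => i; rewrite mulmnE mnm1E; case: eqP => [<-|/eqP ti]; last first.
    by rewrite m0 // eq_sym.
  by rewrite mul1n -md mdegE (bigD1 t) //= big1 ?addn0.
split; last by exists i.
rewrite -md mdegE (bigD1 t) //= (bigD1 i) //=.
by rewrite -[X in (X < _)%N]addn0 ltn_add2l addn_gt0 lt0n mi.
Qed.

Lemma F_split : F = F@_(U_(t) *+ e) *: 'X_[U_(t) *+ e] +
  \sum_(l <- msupp F | l != (U_(t) *+ e)%MM) F@_l *: 'X_[l].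
Proof.
by rewrite {1}[F]mpolyE (bigD1_seq (U_(t) *+ e)%MM) ?mcoeff_msupp ?msupp_uniq.
Qed.

Lemma meval_top (y : 'I_n.+2 -> K) :
  (forall i, i != t -> y i = 0) -> F.@[y] = F@_(U_(t) *+ e) * y t ^+ e.
Proof.
move=> y0; rewrite {1}F_split mevalD raddf_sum /= big_seq_cond big1 ?addr0 => [|l].
  by rewrite mevalZ -mpolyXn rmorphXn /= mevalXU.
case/andP=> l_F nl; have [_ [i it li]] := not_top (dhomogP _ _ _ F_homog l l_F) nl.
by rewrite mevalZ mevalX (bigD1 i) //= y0 // expr0n (negbTE li) mul0r mulr0.
Qed.

Definition reduced k P : Prop := P \is k.-homog /\ low P.

(** The subtraction is truncated; in degrees below [e] the quotients built in [reducibleX] are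
    zero. *)
Definition reducible k P : Prop := exists W Q,
  [/\ reduced k W, Q \is (k - e).-homog & P = W + F * Q].

Lemma reducibleD k P Q : reducible k P -> reducible k Q -> reducible k (P + Q).
Proof.
move=> [W [A [[hW lW] hA ->]]] [W' [A' [[hW' lW'] hA' ->]]].
exists (W + W'), (A + A'); split; [|exact: rpredD|by rewrite mulrDr addrACA].
by split; [apply: rpredD | apply: lowD].
Qed.

Lemma reducibleZ k c P : reducible k P -> reducible k (c *: P).
Proof.
move=> [W [A [[hW lW] hA ->]]]; exists (c *: W), (c *: A).
split; [|exact: rpredZ|by rewrite scalerDr scalerAr].
by split; [apply: rpredZ | apply: lowZ].
Qed.

Lemma reducible0 k : reducible k 0.
Proof.
exists 0, 0; rewrite mulr0 addr0; split; rewrite ?rpred0 //.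
by split; [exact: rpred0 | exact: low0].
Qed.

Lemma reducible_sum k (T : Type) (s : seq T) (p : pred T) (G : T -> S) :
  (forall x, p x -> reducible k (G x)) -> reducible k (\sum_(x <- s | p x) G x).
Proof.
by move=> hG; elim/big_ind: _ => //; [exact: reducible0 | exact: reducibleD].
Qed.

(** Strong induction on the exponent of [x_t]: subtracting a multiple of [F] replaces [x_t^e] by
    monomials with a smaller exponent of [x_t]. *)
Lemma reducibleX m : reducible (mdeg m) 'X_[m].
Proof.
have [N] := ubnP (m t); elim: N m => // N IH m; rewrite ltnS => le_mN.
have [lt_me|le_em] := ltnP (m t) e.
  exists 'X_[m], 0; rewrite mulr0 addr0 rpred0; split=> //; split.
    by rewrite dhomogX.
  by move=> l; rewrite msuppX mem_seq1 => /eqP ->.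
have a0 := F_top; set a := F@_(U_(t) *+ e)%MM in a0;
  pose u := (U_(t) *+ e : 'X_{1..n.+2})%MM.
have le_um : (u <= m)%MM.
  apply/mnm_lepP => i; rewrite mulmnE mnm1E; case: eqP => [<-|_]; last by rewrite mul0n.
  by rewrite mul1n.
have mu_deg : mdeg (m - u)%MM = (mdeg m - e)%N.
  by rewrite -{2}(submK le_um) mdegD mdegMn mdeg1 mul1n addnK.
have -> : 'X_[m] = a^-1 *: (F * 'X_[m - u]) +
    \sum_(l <- msupp F | l != u) (- (a^-1 * F@_l)) *: 'X_[l + (m - u)].
  rewrite {1}F_split -/a mulrDl scalerDr -scalerAl -mpolyXD addmC submK //.
  rewrite scalerA mulVf // scale1r -addrA mulr_suml scaler_sumr -big_split big1 ?addr0 //=.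
  by move=> l _; rewrite -scalerAl -mpolyXD scalerA scaleNr subrr.
apply: reducibleD.
  apply: reducibleZ; exists 0, 'X_[m - u]; rewrite add0r dhomogX /=; split=> //;
    last by rewrite mu_deg.
  by split; [apply: rpred0 | apply: low0].
rewrite big_seq_cond; apply: reducible_sum => l /andP[l_F nl]; apply: reducibleZ.
have ld : mdeg l = e := dhomogP _ _ _ F_homog l l_F.
have -> : mdeg m = mdeg (l + (m - u))%MM.
  rewrite mdegD mu_deg ld subnKC // -(submK le_um) mdegD mdegMn mdeg1 mul1n.
  exact: leq_addl.
apply: IH; have [lt_le _] := not_top ld nl.
rewrite mnmDE mnmBE mulmnE mnm1E eqxx mul1n.
by move: lt_le le_em le_mN; lia.
Qed.

Lemma reduction k P : P \is k.-homog -> reducible k P.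
Proof.
move=> hP; rewrite [P]mpolyE big_seq_cond.
apply: reducible_sum => m /andP[m_P _]; apply: reducibleZ.
by rewrite -(dhomogP _ _ _ hP m m_P); apply: reducibleX.
Qed.

Lemma vanishes_FM Q : vanishes F (F * Q).
Proof. by move=> [y [y0 Fy]] /=; rewrite mevalM Fy mul0r. Qed.

Lemma reduced_rep k P : P \is k.-homog ->
  exists2 W, reduced k W & forall y : cone F, W.@[sval y] = P.@[sval y].
Proof.
move=> /reduction[W [Q [hW _ ->]]]; exists W => // y.
by rewrite mevalD vanishes_FM addr0.
Qed.

End ReducedForms.

(** * Sections of line bundles *)

Section Sections.
Variables (K : numClosedFieldType) (n e : nat) (F : {mpoly K[n.+2]}).
Hypothesis K_nc : not_countable K.
Hypothesis n_gt0 : (0 < n)%N.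
Hypotheses (F_homog : F \is e.-homog) (F_smooth : smooth_hypersurface F).
Local Notation t := (ord_max : 'I_n.+2).
Hypothesis F_top : F@_(U_(t) *+ e) != 0.
Local Notation S := {mpoly K[n.+2]}.
Implicit Types (P Q : S) (m l : 'X_{1..n.+2}) (s : cone F -> K).

Lemma cone_zero (y : cone F) : F.@[sval y] = 0.
Proof. by case: y => y []. Qed.

Definition restr P : cone F -> K := fun y => P.@[sval y].

Lemma restr_section k P : P \is k.-homog -> section_space (F := F) k%:Z (restr P).
Proof.
move=> hP x; exists k, 0%N, P, 1; split=> //.
- exact: dhomog1.
- by rewrite subr0.
- by rewrite meval1 oner_neq0.
- by move=> y _; rewrite meval1 divr1.
Qed.

Lemma section_homogeneous k s (y y' : cone F) c : section_space (F := F) k%:Z s ->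
  c != 0 -> (forall i, sval y' i = c * sval y i) -> s y' = c ^+ k * s y.
Proof.
move=> /(_ y)[i [j [G [H [hG hH ij Hy sE]]]]] c0 y'E.
have evalE P : P.@[sval y'] = P.@[fun x => c * sval y x] by apply: meval_eq.
have Hy' : H.@[sval y'] != 0 by rewrite evalE (meval_homogZ _ _ hH) mulf_neq0 ?expf_neq0.
rewrite !sE // !evalE (meval_homogZ _ _ hG) (meval_homogZ _ _ hH).
have -> : i = (k + j)%N by apply/eqP; move: ij => /eqP; rewrite subr_eq -PoszD eqz_nat.
rewrite exprD invfM; have cj : c ^+ j != 0 by rewrite expf_neq0.
by field; rewrite Hy cj.
Qed.

(* A common zero of the denominators of [s] on the chart [y_i = 1] would be a
   point of the cone, near which [s] has a denominator that is not zero. *)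
Lemma section_chart k s i : section_space (F := F) k%:Z s ->
  exists g : S, forall y : cone F, sval y i = 1 -> s y = g.@[sval y].
Proof.
move=> hs; pose I f := exists g : S, forall y : cone F, sval y i = 1 ->
  f.@[sval y] * s y = g.@[sval y].
suff [g gP] : I 1 by exists g => y /gP; rewrite meval1 mul1r.
apply: contrapT => I1.
have idI : ideal_of I.
  split; first by exists 0 => y _; rewrite !meval0 mul0r.
  - move=> f g [a fa] [b gb]; exists (a + b) => y y1.
    by rewrite !mevalD mulrDl fa ?gb.
  - by move=> h f [a fa]; exists (h * a) => y y1; rewrite !mevalM -mulrA fa.
have [x xI] := nullstellensatz K_nc idI I1.
have Fx : F.@[x] = 0.
  by apply: xI; exists 0 => y _; rewrite cone_zero mul0r meval0.
have x1 : x i = 1.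
  apply/eqP; rewrite -subr_eq0; apply/eqP.
  rewrite -[LHS](_ : ('X_i - 1 : S).@[x] = _); last by rewrite mevalB mevalXU meval1.
  apply: xI; exists 0 => y y1.
  by rewrite mevalB mevalXU meval1 y1 subrr mul0r meval0.
have xP : (exists i, x i != 0) /\ F.@[x] = 0.
  by split=> //; exists i; rewrite x1 oner_neq0.
have [a [b [G [H [_ _ _ /= Hx sE]]]]] := hs (exist _ x xP).
(* The square is needed: [H s = G] is known only where [H] is nonzero, whereas [H^2 s = H G] also
   holds where [H] vanishes. *)
have : (H * H).@[x] = 0.
  apply: xI; exists (H * G) => y _; rewrite !mevalM.
  have [->|Hy] := eqVneq H.@[sval y] 0; first by rewrite !mul0r.
  by rewrite sE // -mulrA; congr (_ * _); rewrite mulrC divfK.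
by move/eqP; rewrite mevalM mulf_eq0 orbb (negbTE Hx).
Qed.

Lemma section_clear k s i : section_space (F := F) k%:Z s ->
  exists N (P : S), P \is (N + k).-homog /\
    forall y : cone F, sval y i ^+ N * s y = P.@[sval y].
Proof.
move=> hs; have [g gP] := section_chart i hs.
pose N := msize g.
pose P0 : S := \sum_(m <- msupp g) g@_m *: 'X_[m + U_(i) *+ (N + k - mdeg m)].
(* [P0] homogenizes [g]. The additional factor [X_i] makes the identity trivial on [y_i = 0], where
   the chart says nothing. *)
exists N.+1, ('X_i * P0); split.
  rewrite addSn -(add1n (N + k)); apply: dhomogM; first by rewrite dhomogX /= mdeg1.
  rewrite /P0 big_seq; apply: rpred_sum => m m_g; apply: rpredZ.
  rewrite dhomogX /= mdegD mdegMn mdeg1 mul1n subnKC //.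
  by rewrite (leq_trans (ltnW (msize_mdeg_lt m_g))) ?leq_addr.
move=> y; rewrite mevalM mevalXU exprS -mulrA.
have [->|yi] := eqVneq (sval y i) 0; first by rewrite !mul0r.
congr (_ * _).
pose x j := (sval y i)^-1 * sval y j.
have xP : (exists j, x j != 0) /\ F.@[x] = 0.
  split; first by exists i; rewrite /x mulVf ?oner_neq0.
  by rewrite (meval_homogZ _ _ F_homog) cone_zero mulr0.
pose y' : cone F := exist _ x xP.
have sy : s y = sval y i ^+ k * s y'.
  by apply: section_homogeneous => // j; rewrite /= /x mulrA mulfV // mul1r.
have gy : s y' = g.@[x] by apply: gP; rewrite /= /x mulVf.
rewrite sy gy mulrA -exprD mevalE mulr_sumr [RHS]raddf_sum.
apply: eq_big_seq => m m_g /=; rewrite mevalZ mulrCA; congr (_ * _).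
rewrite mpolyXD mevalM -mpolyXn rmorphXn /= mevalXU mevalX.
under eq_bigr do rewrite exprMn.
rewrite big_split /=. rewrite prodrXr -mdegE exprVn mulrA mulrC; congr (_ * _).
rewrite -[in LHS](subnK (_ : mdeg m <= N + k)%N).
  by rewrite exprD mulfK // expf_neq0.
by rewrite (leq_trans (ltnW (msize_mdeg_lt m_g))) ?leq_addr.
Qed.

(** By [F_top] the point with only its last coordinate nonzero is off the hypersurface, so the
    charts other than [t] cover it. *)
Lemma cone_coordinate (y : cone F) : exists2 i, i != t & sval y i != 0.
Proof.
apply: contrapT => none.
have y0 i : i != t -> sval y i = 0.
  by move=> it; apply/eqP/negP => /negP yi; apply: none; exists i.
case: y y0 {none} => y [[i yi] Fy] /= y0.
have yt : y t != 0.
  by have [<- //|/y0 E] := eqVneq i t; rewrite E eqxx in yi.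
move: Fy; rewrite (meval_top F_homog F_top y0) => /eqP.
by rewrite mulf_eq0 (negbTE F_top) expf_eq0 (negbTE yt) andbF.
Qed.

(** On each chart [x_i^N s] is a reduced form [W_i]. For [i, j] other than [t], the two products in
    [W_i x_j^N = W_j x_i^N] are still low and agree on the cone, hence are equal as polynomials. As
    [x_0] and [x_1] are coprime, [x_0^N] divides [W_0], and the quotient represents [s]. Having two
    variables besides [x_t] is where [n >= 1] enters. *)
Lemma section_rep k s : section_space (F := F) k%:Z s ->
  exists2 P, reduced e k P & s = restr P.
Proof.
move=> hs.
have /choice[N0 /choice[P0 hP0]] := fun i => section_clear i hs.
pose N := \max_i N0 i.
have le_N i : (N0 i <= N)%N := leq_bigmax i.
have /choice[W hW] : forall i, exists W, reduced e (N + k) W /\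
    forall y : cone F, sval y i ^+ N * s y = W.@[sval y].
  move=> i; have [hPi PiE] := hP0 i.
  have hXP : 'X_i ^+ (N - N0 i) * P0 i \is (N + k).-homog.
    have -> : (N + k = 1 * (N - N0 i) + (N0 i + k))%N by rewrite mul1n addnA subnK.
    by apply: dhomogM => //; apply: dhomogMn; rewrite dhomogX /= mdeg1.
  have [W redW WE] := reduced_rep F_homog F_top hXP.
  exists W; split=> // y; rewrite WE mevalM rmorphXn /= mevalXU -PiE mulrA.
  by rewrite -exprD subnK.
have cross i j : i != t -> j != t -> W i * 'X_j ^+ N = W j * 'X_i ^+ N.
  move=> it jt; apply/eqP; rewrite -subr_eq0; apply/eqP.
  have [[_ lowi] iE] := hW i; have [[_ lowj] jE] := hW j.
  apply: (low_vanishes F_smooth F_top).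
    by apply: lowD; [|apply: lowN]; apply: low_mulXn.
  move=> y; rewrite mevalB !mevalM !rmorphXn /= !mevalXU -iE -jE.
  by rewrite mulrAC [X in _ - X]mulrAC [X in _ - X * _]mulrC subrr.
have lt1 : (1 < n.+2)%N by [].
pose i0 : 'I_n.+2 := ord0; pose i1 := Ordinal lt1.
have i0t : i0 != t by [].
have i1t : i1 != t by rewrite -val_eqE /= eqSS eq_sym -lt0n.
(* Compare coefficients at [m + N U_(i1)]: on the right every monomial is divisible by [x_0^N], and
   multiplying by [x_1^N] does not change the exponent of [x_0]. *)
have W0_div m : m \in msupp (W i0) -> (N <= m i0)%N.
  move=> m_W; have /(congr1 (mcoeff (m + U_(i1) *+ N)%MM)) := cross _ _ i0t i1t.
  rewrite !mpolyXn addmC mcoeffMX mcoeff_mulX.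
  case: ifP => [/mnm_lepP/(_ i0)|_ /eqP];
    last by rewrite (negbTE (_ : _ != 0)) -?mcoeff_msupp.
  by rewrite mnmDE !mulmnE !mnm1E eqxx mul1n mul0n add0n.
pose P := mdivX i0 N (W i0).
have WP : P * 'X_i0 ^+ N = W i0 := mdivXK W0_div.
have Xreg i : ('X_i : S) ^+ N != 0 by rewrite expf_neq0 // -msupp_eq0 msuppX.
have WiP i : i != t -> W i = P * 'X_i ^+ N.
  move=> it; apply: (mulIf (Xreg i0)); rewrite -(cross i0 i) //.
  by rewrite -WP -!mulrA; congr (_ * _); rewrite mulrC.
have P_supp m : m \in msupp P -> (m + U_(i0) *+ N)%MM \in msupp (W i0).
  by move=> m_P; rewrite -WP mpolyXn (perm_mem (msuppMX _ _)) addmC map_f.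
exists P.
  have [[hW0 lowW0] _] := hW i0; split.
    apply/dhomogP => m /P_supp/(dhomogP _ _ _ hW0) /=.
    by rewrite mdegD mdegMn mdeg1 mul1n addnC => /addnI.
  by move=> m /P_supp/lowW0; rewrite mnmDE; apply: leq_ltn_trans; rewrite leq_addr.
apply: funext => y; have [i it yi] := cone_coordinate y.
have [_ iE] := hW i; apply: (mulfI (expf_neq0 N yi)).
by rewrite iE WiP // mevalM rmorphXn /= mevalXU mulrC.
Qed.

Lemma reduced_inj k P Q : reduced e k P -> reduced e k Q -> restr P = restr Q -> P = Q.
Proof.
move=> [_ lowP] [_ lowQ] PQ; apply/eqP; rewrite -subr_eq0; apply/eqP.
apply: (low_vanishes F_smooth F_top); first by apply/lowD/lowN.
by move=> y; rewrite mevalB -[P.@[_]]/(restr P y) PQ subrr.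
Qed.

End Sections.

(** * Slots of a tensor *)

Section Slots.
Variables (J : finType) (p : nat).
Implicit Types (s : {ffun 'I_p -> J}) (u : {ffun 'I_p.+1 -> J}) (i : 'I_p.+1).

Definition rem_slot i u : {ffun 'I_p -> J} := [ffun x => u (fintype.lift i x)].

Definition ins_slot i (j : J) s : {ffun 'I_p.+1 -> J} :=
  [ffun x => if unlift i x is Some y then s y else j].

Lemma ins_slotK i j : cancel (ins_slot i j) (rem_slot i).
Proof. by move=> s; apply/ffunP => x; rewrite !ffunE liftK. Qed.

Lemma ins_slot_id i j s : ins_slot i j s i = j.
Proof. by rewrite ffunE unlift_none. Qed.

Lemma ins_rem_slot i u : ins_slot i (u i) (rem_slot i u) = u.
Proof. by apply/ffunP => x; rewrite ffunE; case: unliftP => [y ->|->] //;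
  rewrite ffunE. Qed.

Lemma sum_ins_slot (V : nmodType) (G : {ffun 'I_p.+1 -> J} -> V) i :
  \sum_u G u = \sum_s \sum_j G (ins_slot i j s).
Proof.
rewrite pair_bigA /= (reindex (fun sj : {ffun 'I_p -> J} * J => ins_slot i sj.2 sj.1)) //.
exists (fun u => (rem_slot i u, u i)) => [[s j] _|u _] /=.
  by rewrite ins_slotK ins_slot_id.
exact: ins_rem_slot.
Qed.

End Slots.

Section Extension.
Variables (K : fieldType) (r d p : nat).
Local Notation S := {mpoly K[r]}.
Local Notation J := (monomials r d).
Implicit Types (s : {ffun 'I_p -> J}) (u : {ffun 'I_p.+1 -> J}) (i : 'I_p.+1).

Lemma rem_upd i u j : rem_slot i (upd u i j) = rem_slot i u.
Proof.
by apply/ffunP => x; rewrite !ffunE eq_sym (negbTE (neq_lift _ _)).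
Qed.

Lemma upd_ins i j j' s : upd (ins_slot i j s) i j' = ins_slot i j' s.
Proof.
apply/ffunP => x; rewrite !ffunE; case: eqP => [->|].
  by rewrite unlift_none.
by case: unliftP => [y ->|->].
Qed.

Lemma rem_upd_lift i k u j :
  rem_slot i (upd u (fintype.lift i k) j) = upd (rem_slot i u) k j.
Proof. by apply/ffunP => x; rewrite !ffunE (inj_eq lift_inj). Qed.

(** The tensor sum of the [h_j], each with [x^j] inserted in slot [i]. *)
Definition ext i (h : J -> {ffun 'I_p -> J} -> S) u : S := h (u i) (rem_slot i u).

Lemma contract_ext i h u :
  contract (ext i h) i u = \sum_j h j (rem_slot i u) * 'X_[mon j].
Proof.
by apply: eq_bigr => j _; rewrite /ext rem_upd updE eqxx.
Qed.

Lemma contract_ext_lift i k h u :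
  contract (ext i h) (fintype.lift i k) u = contract (h (u i)) k (rem_slot i u).
Proof.
apply: eq_bigr => j _; rewrite /ext rem_upd_lift updE.
by rewrite (negbTE (neq_lift _ _)).
Qed.

Lemma sum_ins_contract i (a : {ffun 'I_p.+1 -> J} -> S) s :
  (forall u, contract a i u = 0) ->
  \sum_j a (ins_slot i j s) * 'X_[mon j] = 0.
Proof.
move=> a0; case: (pickP (@predT J)) => [j0 _|J0]; last by rewrite big_pred0.
rewrite -[RHS](a0 (ins_slot i j0 s)); apply: eq_bigr => j _.
by rewrite upd_ins.
Qed.

End Extension.

(** * Exterior powers by generators and relations *)

Section FreegLinear.
Variables (K : fieldType) (T : choiceType) (V : lmodType K).
Implicit Types (f : T -> V) (c : {freeg T / K}).

HB.instance Definition _ f := GRing.isZmodMorphism.Build {freeg T / K} V (fglift f)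
  (lift_is_additive f).

Lemma fglift_sumE f c : fglift f c = \sum_(z <- dom c) coeff z c *: f z.
Proof.
by rewrite -{1}[c]freeg_sumE raddf_sum /=; apply: eq_bigr => z _; rewrite liftU.
Qed.

Lemma scale_freegU a k (x : T) : a *: (<< k *g x >> : {freeg T / K}) = << (a * k) *g x >>.
Proof.
by apply/eqP/freeg_eqP => y; rewrite coeffZ !coeffU mulrA.
Qed.

Lemma fgliftZ f a c : fglift f (a *: c) = a *: fglift f c.
Proof.
rewrite -{1}[c]freeg_sumE scaler_sumr raddf_sum fglift_sumE scaler_sumr /=.
by apply: eq_bigr => z _; rewrite scale_freegU liftU scalerA.
Qed.

HB.instance Definition _ f :=
  GRing.isScalable.Build K {freeg T / K} V *:%R (fglift f) (fgliftZ f).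

Lemma fgliftU f x : fglift f << x >> = f x.
Proof. by rewrite liftU scale1r. Qed.

Lemma freeg_sumZ c : c = \sum_(z <- dom c) coeff z c *: << z >>.
Proof.
rewrite -{1}[c]freeg_sumE; apply: eq_bigr => z _.
by rewrite scale_freegU mulr1.
Qed.

End FreegLinear.

Section WedgeRelations.
Variables (K : fieldType) (T : Type).
Local Notation fn := (T -> K).
Implicit Types (V M : set fn) (m : fn).

Definition linear_set V : Prop :=
  V (cst 0) /\ forall a v w, V v -> V w -> V (cst a * v + w).

Lemma cst0_id a : cst a * cst 0 + cst 0 = cst 0 :> fn.
Proof.
apply: funext => x; transitivity (a * 0 + 0) => //.
by rewrite mulr0 addr0.
Qed.

Definition vseq n (v : 'I_n -> fn) : seq fn := [seq v i | i <- enum 'I_n].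

Lemma size_vseq n v : size (@vseq n v) = n.
Proof. by rewrite size_map size_enum_ord. Qed.

Lemma nth_vseq n v (i : 'I_n) : nth 0 (vseq v) i = v i.
Proof. by rewrite (nth_map i) ?size_enum_ord // nth_ord_enum. Qed.

Lemma eq_vseq n v w : v =1 w -> @vseq n v = vseq w.
Proof. by move=> vw; apply: eq_map. Qed.

Lemma vseq_nth n (s : seq fn) : size s = n -> s = vseq (fun i : 'I_n => nth 0 s i).
Proof.
move=> sz; apply: (@eq_from_nth _ 0) => [|i]; rewrite ?size_vseq // sz => lt_in.
by rewrite (nth_vseq _ (Ordinal lt_in)).
Qed.

Lemma vseqS n (v : 'I_n.+1 -> fn) :
  vseq v = v ord0 :: vseq (v \o fintype.lift ord0).
Proof. by rewrite /vseq enum_ordSl /= -map_comp. Qed.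

Lemma vseq_rem n (v : 'I_n.+1 -> fn) (k : 'I_n.+1) :
  take k (vseq v) ++ drop k.+1 (vseq v) = vseq (v \o fintype.lift k).
Proof.
have le_kn : (k <= n)%N by rewrite -ltnS.
have szt : size (take k (vseq v)) = k.
  by rewrite size_take size_vseq ltn_ord.
apply: (@eq_from_nth _ 0) => [|i].
  by rewrite size_cat szt size_drop !size_vseq subSS subnKC.
rewrite size_cat szt size_drop !size_vseq subSS subnKC // => lt_in.
rewrite (nth_vseq _ (Ordinal lt_in)) /= -nth_vseq /= nth_cat szt /bump.
case: ltnP => [lt_ik|le_ki]; first by rewrite nth_take.
by rewrite nth_drop addSn subnKC.
Qed.

Lemma mem_vseq n (v : 'I_n -> fn) w : w \in vseq v -> exists i, w = v i.
Proof. by case/mapP => i _ ->; exists i. Qed.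

Section Modulo.
Variables (V M : set fn) (p : int).
Hypotheses (V_lin : linear_set V) (M_lin : linear_set M).
Local Notation null := (wedge_null V M p).
Local Notation gen := (is_gen V M p).
Implicit Types (c : {freeg (wedge_gen K T) / K}).

Definition eqv (x y : {freeg (wedge_gen K T) / K}) : Prop := null (x - y).

Lemma nullZ a c : null c -> null (a *: c).
Proof. by move=> nc; rewrite -[a *: c]addr0;
  apply: wedge_nullD nc (wedge_null0 _ _ _). Qed.

Lemma nullD c c' : null c -> null c' -> null (c + c').
Proof. by move=> nc nc'; rewrite -[c]scale1r; apply: wedge_nullD. Qed.

Lemma eqv_refl x : eqv x x.
Proof. by rewrite /eqv subrr; apply: wedge_null0. Qed.

Lemma eqv_sym x y : eqv x y -> eqv y x.
Proof. by move=> xy; rewrite /eqv -opprB -scaleN1r; apply: nullZ. Qed.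

Lemma eqv_trans y x z : eqv x y -> eqv y z -> eqv x z.
Proof.
by move=> xy yz; rewrite /eqv -(subrK y x) -addrA; apply: nullD.
Qed.

Lemma eqvD x x' y y' : eqv x y -> eqv x' y' -> eqv (x + x') (y + y').
Proof. by move=> xy xy'; rewrite /eqv opprD addrACA; apply: nullD. Qed.

Lemma eqvZ a x y : eqv x y -> eqv (a *: x) (a *: y).
Proof. by move=> xy; rewrite /eqv -scalerBr; apply: nullZ. Qed.

Lemma eqvN x y : eqv x y -> eqv (- x) (- y).
Proof. by move=> xy; rewrite -scaleN1r -[- y]scaleN1r; apply: eqvZ. Qed.

Lemma eqv_sum (I : Type) (s : seq I) (P : pred I) (f g : I -> {freeg (wedge_gen K T) / K}) :
  (forall i, P i -> eqv (f i) (g i)) ->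
  eqv (\sum_(i <- s | P i) f i) (\sum_(i <- s | P i) g i).
Proof. by move=> fg; elim/big_rec2: _ => [|i x y /fg]; [exact: eqv_refl|exact: eqvD]. Qed.

Lemma eqv_sum0 (I : Type) (s : seq I) (f : I -> {freeg (wedge_gen K T) / K}) :
  (forall i, eqv (f i) 0) -> eqv (\sum_(i <- s) f i) 0.
Proof.
move=> f0; elim/big_ind: _ => [|x y x0 y0|i _ //]; first exact: eqv_refl.
by rewrite -[X in eqv _ X]addr0; apply: eqvD.
Qed.

Lemma linear_set_sum (W : set fn) (I : Type) (s : seq I) (c : I -> K) (f : I -> fn) :
  linear_set W -> (forall i, W (f i)) -> W (\sum_(i <- s) cst (c i) * f i).
Proof.
move=> [W0 WL] Wf; elim: s => [|i s IH]; first by rewrite big_nil.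
by rewrite big_cons; apply: WL.
Qed.

Lemma eqv_vec_sum s1 s2 m (I : Type) (r : seq I) (c : I -> K) (f : I -> fn) :
  (forall v, V v -> gen (s1 ++ v :: s2, m)) -> (forall i, V (f i)) ->
  eqv (pure (s1 ++ (\sum_(i <- r) cst (c i) * f i) :: s2) m)
      (\sum_(i <- r) c i *: pure (s1 ++ f i :: s2) m).
Proof.
move=> g Vf; elim: r => [|i r IH].
  (* The linearity relation with scalar 1 and both vectors zero says that a generator with a zero
     entry equals twice itself. *)
  rewrite !big_nil; have := wedge_null_vec 1 (g _ V_lin.1) (g _ V_lin.1).
  rewrite cst0_id.
  rewrite scale1r opprD addNKr -scaleN1r => /(nullZ (-1)).
  by rewrite scalerA mulrNN mulr1 scale1r /eqv subr0.
rewrite !big_cons.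
apply: eqv_trans (wedge_null_vec _ (g _ (Vf i)) (g _ (linear_set_sum _ _ V_lin Vf))) _.
exact/eqvD/IH/eqv_refl.
Qed.

Lemma eqv_coef_sum v (I : Type) (r : seq I) (c : I -> K) (f : I -> fn) :
  (forall m, M m -> gen (v, m)) -> (forall i, M (f i)) ->
  eqv (pure v (\sum_(i <- r) cst (c i) * f i)) (\sum_(i <- r) c i *: pure v (f i)).
Proof.
move=> g Mf; elim: r => [|i r IH].
  rewrite !big_nil; have := wedge_null_coef 1 (g _ M_lin.1) (g _ M_lin.1).
  rewrite cst0_id.
  rewrite scale1r opprD addNKr -scaleN1r => /(nullZ (-1)).
  by rewrite scalerA mulrNN mulr1 scale1r /eqv subr0.
rewrite !big_cons.
apply: eqv_trans (wedge_null_coef _ (g _ (Mf i)) (g _ (linear_set_sum _ _ M_lin Mf))) _.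
exact/eqvD/IH/eqv_refl.
Qed.

(** The prefix [s1] collects the entries already expanded, so that the induction can proceed from
    left to right. *)
Lemma eqv_expand (J : finType) (X : J -> fn) n (s1 : seq fn) (v : 'I_n -> fn) m
    (c : 'I_n -> J -> K) :
  (forall j, V (X j)) -> (forall i, v i = \sum_j cst (c i j) * X j) ->
  (forall w : 'I_n -> fn, (forall i, V (w i)) -> gen (s1 ++ vseq w, m)) ->
  eqv (pure (s1 ++ vseq v) m)
    (\sum_(s : {ffun 'I_n -> J}) (\prod_i c i (s i)) *: pure (s1 ++ vseq (X \o s)) m).
Proof.
move=> VX; elim: n s1 v c => [|n IH] s1 v c vE g.
  rewrite (eq_bigr (fun=> pure (s1 ++ vseq v) m)) => [|s _]; last first.
    by rewrite big_ord0 scale1r; congr (pure (_ ++ _) m); apply: eq_vseq => -[].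
  by rewrite sumr_const card_ffun card_ord expn0 mulr1n; apply: eqv_refl.
have Vv i : V (v i) by rewrite vE; apply: linear_set_sum.
rewrite (sum_ins_slot _ ord0) exchange_big /= vseqS vE.
apply: eqv_trans (eqv_vec_sum _ _ _ VX) _ => [w Vw|].
  have := g (fun i => if unlift ord0 i is Some j then v (fintype.lift ord0 j) else w).
  rewrite vseqS unlift_none (_ : vseq (_ \o _) = vseq (v \o fintype.lift ord0));
    last first.
    by apply: eq_vseq => i /=; rewrite liftK.
  by apply=> i; case: unlift.
apply: eqv_sum => j _; rewrite -cat_rcons.
apply: eqv_trans (eqvZ _ (IH (rcons s1 (X j)) _ (fun i => c (fintype.lift ord0 i)) _ _)) _.
- by move=> i; apply: vE.
- move=> w Vw; rewrite cat_rcons.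
  have := g (fun i => if unlift ord0 i is Some j then w j else X j).
  rewrite vseqS unlift_none (_ : vseq (_ \o _) = vseq w); last first.
    by apply: eq_vseq => i /=; rewrite liftK.
  by apply=> i; case: unlift.
rewrite scaler_sumr; apply: eqv_sum => s _; rewrite scalerA.
rewrite big_ord_recl ins_slot_id cat_rcons vseqS /= ins_slot_id.
have E (i : 'I_n) : ins_slot ord0 j s (fintype.lift ord0 i) = s i.
  by rewrite ffunE liftK.
under [X in eqv _ (_ * X *: _)]eq_bigr do rewrite E.
rewrite [vseq (_ \o fintype.lift ord0)](eq_vseq (w := X \o s)) => [|i /=];
  first exact: eqv_refl.
by rewrite E.
Qed.

(** Polarization: expand the alternating relation with [x + y] in both places. *)
Lemma eqv_swap s1 s2 s3 (x y : fn) m : V x -> V y ->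
  (forall a b, V a -> V b -> gen (s1 ++ a :: s2 ++ b :: s3, m)) ->
  eqv (pure (s1 ++ x :: s2 ++ y :: s3) m) (- pure (s1 ++ y :: s2 ++ x :: s3) m).
Proof.
move=> Vx Vy g; pose G a b := pure (s1 ++ a :: s2 ++ b :: s3) m.
pose w := cst 1 * x + y; have Vw : V w by apply: V_lin.2.
have G0 a : V a -> eqv (G a a) 0.
  by move=> Va; rewrite /eqv subr0; apply: wedge_null_alt; apply: g.
have GDr a : V a -> eqv (G a w) (G a x + G a y).
  move=> Va; rewrite -[G a x]scale1r /G.
  have E b : s1 ++ a :: s2 ++ b :: s3 = (s1 ++ a :: s2) ++ b :: s3 by rewrite -catA.
  by rewrite !E; apply: wedge_null_vec; rewrite -E; apply: g.
have GDl : eqv (G w w) (G x w + G y w).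
  by rewrite -[G x w]scale1r; apply: wedge_null_vec; apply: g.
have : eqv 0 (G x y + G y x).
  apply: eqv_trans (eqv_sym (G0 _ Vw)) (eqv_trans GDl _).
  rewrite -[G x y]add0r -[G y x]addr0.
  by apply: eqvD; [apply: eqv_trans (GDr _ Vx) _ | apply: eqv_trans (GDr _ Vy) _];
    apply: eqvD; rewrite ?eqv_refl //; (exact: G0 || exact: eqv_refl).
by move/eqv_sym; rewrite /eqv subr0 opprK.
Qed.

Section Permutation.
Variables (n : nat) (m : fn).
Hypothesis gen_m : forall w : 'I_n -> fn, (forall i, V (w i)) -> gen (vseq w, m).
Implicit Types (v : 'I_n -> fn).

Lemma eqv_tperm v i j : (forall i, V (v i)) -> i != j ->
  eqv (pure (vseq (v \o tperm i j)) m) (- pure (vseq v) m).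
Proof.
move=> Vv ij.
have main a b e1 e2 e3 : enum 'I_n = e1 ++ a :: e2 ++ b :: e3 ->
    tperm a b = tperm i j ->
    eqv (pure (vseq (v \o tperm i j)) m) (- pure (vseq v) m).
  move=> enumE tE; have := enum_uniq 'I_n; rewrite enumE => u.
  have nin x : x \in e1 ++ e2 ++ e3 -> (x != a) && (x != b).
    move: u; rewrite !cat_uniq /= !cat_uniq /= !has_cat /= !mem_cat !inE.
    rewrite !negb_or => /and3P[_ /and3P[ae1 _ /andP[be1 _]]].
    case/andP => /and3P[ae2 ab ae3] /and3P[_ /andP[be2 _] /andP[be3 _]].
    by case/or3P => xe; rewrite -(negbK (_ && _)) negb_and !negbK;
      apply/negP => /orP[] /eqP E; move: xe; rewrite E; apply/negP.
  have ab : a != b.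
    apply: contraTneq u => ->; rewrite cat_uniq /= mem_cat inE eqxx orbT /=.
    by rewrite !andbF.
  have mapE e : {subset e <= e1 ++ e2 ++ e3} ->
      [seq (v \o tperm i j) x | x <- e] = [seq v x | x <- e].
    move=> se; apply/eq_in_map => x /se/nin/andP[xa xb].
    by rewrite /= -tE tpermD // eq_sym.
  have E1 : vseq (v \o tperm i j) = [seq v x | x <- e1] ++ v b ::
      [seq v x | x <- e2] ++ v a :: [seq v x | x <- e3].
    rewrite /vseq enumE map_cat /= map_cat /= !mapE ?tE //.
    - by rewrite -tE tpermL tpermR.
    - by move=> x xe; rewrite !mem_cat xe !orbT.
    - by move=> x xe; rewrite !mem_cat xe !orbT.
    - by move=> x xe; rewrite !mem_cat xe.
  rewrite E1 /vseq enumE map_cat /= map_cat /=.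
  apply: eqv_swap => // x y Vx Vy.
  have := @gen_m (fun z => if z == a then x else if z == b then y else v z).
  have mapF e : {subset e <= e1 ++ e2 ++ e3} ->
      [seq (if z == a then x else if z == b then y else v z) | z <- e] =
      [seq v z | z <- e].
    by move=> se; apply/eq_in_map => z /se/nin/andP[/negbTE -> /negbTE ->].
  rewrite /vseq enumE map_cat /= map_cat /= !mapF.
  - rewrite eqxx eq_sym (negbTE ab) eqxx; apply=> z.
    by case: ifP => // _; case: ifP.
  - by move=> z ze; rewrite !mem_cat ze !orbT.
  - by move=> z ze; rewrite !mem_cat ze !orbT.
  - by move=> z ze; rewrite !mem_cat ze.
have : i \in enum 'I_n by rewrite mem_enum.
case/splitPr E : _ / => [e1 e2].
have : j \in e1 ++ i :: e2 by rewrite -E mem_enum.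
rewrite mem_cat inE eq_sym (negbTE ij) /= => /orP[] /splitPr j_e.
  by case: j_e E => e3 e4; rewrite -catA => /main; apply; apply: tpermC.
by case: j_e E => e3 e4 /main; apply.
Qed.

Lemma eqv_perm v (s : 'S_n) : (forall i, V (v i)) ->
  eqv (pure (vseq (v \o s)) m) ((-1) ^+ s *: pure (vseq v) m).
Proof.
move=> Vv; have [ts -> ] := prod_tpermP s.
elim: ts => [_|[i j] ts IH /= /andP[ij /IH{}IH]].
  rewrite big_nil odd_perm1 scale1r (eq_vseq (w := v)) => [|i]; first exact: eqv_refl.
  by rewrite /= perm1.
rewrite big_cons odd_permM odd_tperm ij signr_addb expr1 mulN1r scaleNr.
set s' := (\prod_(_ <- _) _)%g in IH *.
rewrite (eq_vseq (w := (v \o s') \o tperm i j)) => [|x]; last by rewrite /= permM.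
apply: eqv_trans (eqv_tperm _ ij) _ => [x|]; first exact: Vv.
exact: eqvN.
Qed.

(** Expand the determinant over permutations [t]: the sum over [s] reassembles the product of the
    permuted vectors, whose sign cancels that of [t]. Summing over all families, instead of
    increasing ones, produces the factor [n!]. *)
Lemma eqv_det (J : finType) (X : J -> fn) (v : 'I_n -> fn) (c : 'I_n -> J -> K) :
  (forall j, V (X j)) -> (forall i, v i = \sum_j cst (c i j) * X j) ->
  eqv (\sum_(s : {ffun 'I_n -> J})
         \det (\matrix_(l, a) c l (s a)) *: pure (vseq (X \o s)) m)
      (n`!%:R *: pure (vseq v) m).
Proof.
move=> VX vE; have Vv i : V (v i) by rewrite vE; apply: linear_set_sum.
have -> : \sum_(s : {ffun 'I_n -> J})
     \det (\matrix_(l, a) c l (s a)) *: pure (vseq (X \o s)) m =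
  \sum_(t : 'S_n) (-1) ^+ t *: \sum_(s : {ffun 'I_n -> J})
     (\prod_a c (t a) (s a)) *: pure (vseq (X \o s)) m.
  under [RHS]eq_bigr do rewrite scaler_sumr.
  rewrite exchange_big; apply: eq_bigr => s _ /=.
  rewrite -det_tr /determinant scaler_suml; apply: eq_bigr => t _.
  by rewrite scalerA; congr (_ * _ *: _); apply: eq_bigr => a _; rewrite !mxE.
have -> : n`!%:R *: pure (vseq v) m = \sum_(t : 'S_n) pure (vseq v) m.
  by rewrite sumr_const card_Sn scaler_nat.
apply: eqv_sum => t _.
apply: eqv_trans (eqvZ _ (eqv_sym (eqv_expand (s1 := [::]) VX
  (fun i => vE (t i)) gen_m))) _.
apply: eqv_trans (eqvZ _ (eqv_perm t Vv)) _.
by rewrite scalerA -signr_addb addbb scale1r; apply: eqv_refl.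
Qed.

End Permutation.
End Modulo.

Lemma koszul_diff_gen (g : wedge_gen K T) :
  koszul_diff << g >> = \sum_(k < size g.1)
    (-1) ^+ k *: pure (take k g.1 ++ drop k.+1 g.1) (nth 0 g.1 k * g.2).
Proof. exact: fgliftU. Qed.

Lemma koszul_diff_vseq n (v : 'I_n.+1 -> fn) m :
  koszul_diff (pure (vseq v) m) =
  \sum_(k < n.+1) (-1) ^+ k *: pure (vseq (v \o fintype.lift k)) (v k * m).
Proof.
rewrite koszul_diff_gen /=.
rewrite -(big_mkord xpredT (fun k => (-1) ^+ k *:
   pure (take k (vseq v) ++ drop k.+1 (vseq v)) (nth 0 (vseq v) k * m))).
rewrite size_vseq big_mkord; apply: eq_bigr => k _.
by rewrite vseq_rem nth_vseq.
Qed.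

End WedgeRelations.

(** * From Koszul chains to tensors *)

Section Coordinates.
Variables (K : numClosedFieldType) (n e : nat) (F : {mpoly K[n.+2]}).
Hypothesis K_nc : not_countable K.
Hypothesis n_gt0 : (0 < n)%N.
Hypotheses (F_homog : F \is e.-homog) (F_smooth : smooth_hypersurface F).
Hypothesis F_top : F@_(U_(ord_max) *+ e) != 0.
Local Notation S := {mpoly K[n.+2]}.
Local Notation fn := (cone F -> K).
Local Notation sec k := (section_space (F := F) k%:Z).
Implicit Types (P Q : S) (v w m : fn).

(** On sections this is a linear splitting of the map from forms to their classes modulo [F]; [xget]
    returns 0 on other functions. *)
Definition rep k v : S := xget 0 [set P | reduced e k P /\ v = restr (F := F) P]%classic.

Lemma repP k v : sec k v -> reduced e k (rep k v) /\ v = restr (rep k v).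
Proof.
move=> /(section_rep K_nc n_gt0 F_homog F_smooth F_top)[P redP vP].
by apply: (@xgetPex _ 0 [set P | reduced e k P /\ v = restr P]%classic); exists P.
Qed.

Lemma rep_homog k v : sec k v -> rep k v \is k.-homog.
Proof. by case/repP => -[]. Qed.

Lemma rep_unique k v P : reduced e k P -> v = restr P -> rep k v = P.
Proof.
move=> redP vP; have vsec : sec k v by rewrite vP; apply: restr_section; case: redP.
have [redv vE] := repP vsec.
by apply: (reduced_inj F_smooth F_top redv redP); rewrite -vE.
Qed.

Lemma rep_linear k a v w : sec k v -> sec k w ->
  rep k (cst a * v + w) = a *: rep k v + rep k w.
Proof.
move=> /repP[[hv lv] vE] /repP[[hw lw] wE]; apply: rep_unique.
  split; first by apply: rpredD => //; apply: rpredZ.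
  by apply: lowD => //; apply: lowZ.
by apply: funext => y; rewrite {1}vE {1}wE /restr mevalD mevalZ.
Qed.

Lemma linear_sec k : linear_set (sec k).
Proof.
split.
  rewrite (_ : cst 0 = restr (F := F) 0); first by apply/restr_section/rpred0.
  by apply: funext => y; rewrite /restr meval0.
move=> a v w /repP[[hv _] ->] /repP[[hw _] ->].
rewrite (_ : _ + _ = restr (F := F) (a *: rep k v + rep k w)).
  by apply: restr_section; apply: rpredD => //; apply: rpredZ.
by apply: funext => y; rewrite /restr mevalD mevalZ.
Qed.

Lemma homog_mon d P : P \is d.-homog -> P = \sum_(j : monomials n.+2 d) P@_(mon j) *: 'X_[mon j].
Proof.
move=> hP; apply/mpolyP => m; rewrite raddf_sum /=.
under eq_bigr do rewrite mcoeffZ mcoeffX.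
have [md|md] := eqVneq (mdeg m) d.
  have [j jm] := mon_surj md; rewrite (bigD1 j) //= jm eqxx mulr1 big1 ?addr0 // => i ij.
  by rewrite -jm (inj_eq (@mon_inj _ _)) (negbTE ij) mulr0.
rewrite (dhomog_nemf_coeff hP md) big1 // => j _.
case: eqP => [jm|_]; last by rewrite mulr0.
by rewrite -jm mdeg_mon eqxx in md.
Qed.

Lemma sec_mon d v : sec d v ->
  v = \sum_(j : monomials n.+2 d) cst (rep d v)@_(mon j) * restr (F := F) 'X_[mon j].
Proof.
move=> vsec; have [_ vE] := repP vsec; rewrite {1}vE.
rewrite {1}(homog_mon (rep_homog vsec)); apply: funext => y.
rewrite /restr raddf_sum fct_sumE /=.
by apply: eq_bigr => j _; rewrite mevalZ.
Qed.

Section Functional.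
Variables (d k p : nat).
Local Notation J := (monomials n.+2 d).

Definition cmatrix (q : seq fn) (s : {ffun 'I_p -> J}) : 'M[K]_p :=
  \matrix_(l, a) (rep d (nth 0 q l))@_(mon (s a)).

(** The coefficient at the basis tensor [s] of the antisymmetrization of the wedge product, without
    division by [p!]. *)
Definition coord (s : {ffun 'I_p -> J}) (g : wedge_gen K (cone F)) : S :=
  \det (cmatrix g.1 s) *: rep k g.2.

Lemma nth_mid (q q' : seq fn) x i :
  nth 0 (q ++ x :: q') i = if i == size q then x else
    if (i < size q)%N then nth 0 q i else nth 0 q' (i - (size q).+1).
Proof.
rewrite nth_cat; case: ltngtP => // [lt_qi|->]; last by rewrite subnn.
by rewrite -(subnSK lt_qi).
Qed.

(** The coordinates descend to the quotient because determinants are multilinear and alternating in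
    their rows. *)
Lemma coord_null s c : wedge_null (sec d) (sec k) p%:Z c -> fglift (coord s) c = 0.
Proof.
elim=> {c} [|a c c' _ IH _ IH'|a q q' v w m [sz Vv Mm] [_ Vw _]
  |a q m m' [_ _ Mm] [_ _ Mm']|q q' q'' v m [sz _ _]].
- by rewrite raddf0.
- by rewrite linearP /= IH IH' scaler0 addr0.
- have {}Vv : sec d v by apply: Vv; rewrite mem_cat mem_head orbT.
  have {}Vw : sec d w by apply: Vw; rewrite mem_cat mem_head orbT.
  have lt_p : (size q < p)%N by case: sz => <-; rewrite size_cat /= addnS ltnS leq_addr.
  pose l0 := Ordinal lt_p.
  have lift_neq y : (fintype.lift l0 y == size q :> nat) = false.
    by apply/negbTE; rewrite eq_sym; apply: (neq_lift l0 y).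
  have detE : \det (cmatrix (q ++ (cst a * v + w) :: q') s) =
      a * \det (cmatrix (q ++ v :: q') s) + 1 * \det (cmatrix (q ++ w :: q') s).
    apply: (determinant_multilinear (i0 := l0)).
    + apply/rowP => x; rewrite !mxE !nth_mid eqxx rep_linear // mul1r.
      by rewrite mcoeffD mcoeffZ.
    + apply/matrixP => y x; rewrite !mxE !nth_mid.
      by rewrite lift_neq.
    + apply/matrixP => y x; rewrite !mxE !nth_mid.
      by rewrite lift_neq.
  rewrite /pure linearB linearP /= !fgliftU /coord /= detE mul1r.
  by rewrite scalerDl scalerA subrr.
- rewrite /pure linearB linearP /= !fgliftU /coord /= rep_linear //.
  by rewrite scalerDr !scalerA mulrC subrr.
- have szE : p = (size q + (size q' + size q'').+2)%N.
    by case: sz => <-; rewrite size_cat /= size_cat /= !addnS.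
  have lt1 : (size q < p)%N by rewrite szE -addSnnS leq_addr.
  have lt2 : (size q + (size q').+1 < p)%N.
    by rewrite szE -addnS leq_add2l !ltnS leq_addr.
  rewrite /pure fgliftU /coord /= (determinant_alternate (i1 := Ordinal lt1) (i2 := Ordinal lt2)).
  + by rewrite scale0r.
  + by rewrite -val_eqE /= -[X in X == _]addn0 eqn_add2l.
  + move=> x; rewrite !mxE /= !nth_cat ltnn subnn ltnNge leq_addr /= addKn /=.
    by rewrite nth_cat ltnn subnn.
Qed.

(* The contraction of slot [i] is a Laplace expansion along column [i]. *)
Definition contracted (s : {ffun 'I_p -> J}) (q : seq fn) (m : fn) : S :=
  \sum_(l < p.+1) (-1) ^+ l *:
    (\det (cmatrix (take l q ++ drop l.+1 q) s) *: (rep d (nth 0 q l) * rep k m)).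

End Functional.

Lemma contract_coord d k p (q : seq fn) m (i : 'I_p.+1) (u : {ffun 'I_p.+1 -> monomials n.+2 d}) :
  size q = p.+1 -> (forall v, v \in q -> sec d v) ->
  contract (fun u => coord k u (q, m)) i u = (-1) ^+ i *: contracted k (rem_slot i u) q m.
Proof.
move=> szq Vq; rewrite /contract /coord /=.
transitivity (\sum_(j : monomials n.+2 d) \sum_(l < p.+1) ((-1) ^+ (l + i) *
    \det (cmatrix (take l q ++ drop l.+1 q) (rem_slot i u)) *
     (rep d (nth 0 q l))@_(mon j)) *: ('X_[mon j] * rep k m)).
  apply: eq_bigr => j _; rewrite (expand_det_col _ i) -scaler_suml mulrC -scalerAr;
    congr (_ *: _).
  apply: eq_bigr => l _; rewrite mulrC mxE updE eqxx /cofactor; congr (_ * \det _ * _).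
  apply/matrixP => y x; rewrite !mxE.
  rewrite updE eq_sym (negbTE (neq_lift _ _)) ffunE; congr (_@__); congr (rep d _).
  rewrite nth_cat size_take szq ltn_ord /= /bump.
  case: ltnP => [lt_yl|le_ly].
    by rewrite nth_take.
  by rewrite nth_drop addSn subnKC.
rewrite exchange_big /contracted scaler_sumr; apply: eq_bigr => l _ /=.
have Vl : sec d (nth 0 q l) by apply: Vq; rewrite mem_nth // szq.
rewrite {2}(homog_mon (rep_homog Vl)) mulr_suml !scaler_sumr.
apply: eq_bigr => j _; rewrite -scalerAl !scalerA; congr (_ *: _).
by rewrite exprD; ring.
Qed.

End Coordinates.

(** * Lifting cycles from [S/F] to [S] *)

Section CycleQuotient.
Variables (K : numClosedFieldType) (n e : nat) (F : {mpoly K[n.+2]}).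
Hypothesis K_nc : not_countable K.
Hypothesis n_gt0 : (0 < n)%N.
Hypotheses (F_homog : F \is e.-homog) (F_smooth : smooth_hypersurface F).
Hypothesis F_top : F@_(U_(ord_max) *+ e) != 0.
Local Notation S := {mpoly K[n.+2]}.
Local Notation fn := (cone F -> K).
Local Notation sec k := (section_space (F := F) k%:Z).
Local Notation J d := (monomials n.+2 d).
Implicit Types (P Q : S) (v w m : fn).

Let repE k v (vk : sec k v) := repP K_nc n_gt0 F_homog F_smooth F_top vk.

Lemma F_neq0 : F != 0.
Proof. by apply: contraNneq F_top => ->; rewrite mcoeff0. Qed.

Lemma hlow_homog (k : nat) P : hlow 0 k P <-> P \is k.-homog.
Proof.
split=> [h|/dhomogP h]; first by apply/dhomogP => m /h[].
by move=> m /h <-; split=> //; apply/mlowP.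
Qed.

Lemma rep_sec k m : sec k (restr (rep e k m)).
Proof.
rewrite /rep; case: xgetP => [P -> [[hP _] _]|_]; first exact: restr_section.
exact/restr_section/rpred0.
Qed.

(** [rep] is not multiplicative; the error [F * Q] is what the quotient [g] of a cycle is made
    of. *)
Lemma mul_rep d k v m : sec d v -> sec k m -> exists2 Q, Q \is (k + d - e).-homog &
  rep e d v * rep e k m = rep e (k + d) (v * m) + F * Q.
Proof.
move=> vd mk; have [[hv _] vE] := repE vd; have [[hm _] mE] := repE mk.
have := dhomogM hv hm; rewrite addnC => /(reduction F_homog F_top)[W [Q [redW hQ E]]].
exists Q => //; rewrite E; congr (_ + _); apply/esym/(rep_unique K_nc n_gt0) => //.
apply: funext => y; transitivity (v y * m y) => //.
rewrite {1}vE {1}mE /restr -mevalM E mevalD mevalM cone_zero mul0r addr0 //.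
Qed.

Section Cycle.
Variables (d k p : nat).
Local Notation slots := {ffun 'I_p.+1 -> J d}.
Variable c : {freeg (wedge_gen K (cone F)) / K}.
Hypothesis c_chain : wedge_chain (sec d) (sec k) p.+1%:Z c.
Hypothesis c_cycle : wedge_null (sec d) (sec (k + d)) p%:Z (koszul_diff c).

Definition cycle_coord (u : slots) : S := fglift (coord e k u) c.

Lemma dom_gen z : z \in dom c -> is_gen (sec d) (sec k) p.+1%:Z z.
Proof. by rewrite mem_dom => /c_chain. Qed.

Lemma cycle_coordE u : cycle_coord u = \sum_(z <- dom c) coeff z c *: coord e k u z.
Proof. exact: fglift_sumE. Qed.

Lemma cycle_coord_homog u : cycle_coord u \is k.-homog.
Proof.
rewrite cycle_coordE big_seq; apply: rpred_sum => z /dom_gen[_ _ zk].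
by apply/rpredZ/rpredZ; apply: (rep_homog K_nc n_gt0 F_homog F_smooth F_top).
Qed.

Lemma cycle_coord_tperm (u : slots) i j : i != j ->
  cycle_coord [ffun x => u (tperm i j x)] = - cycle_coord u.
Proof.
move=> ij; rewrite !cycle_coordE -sumrN; apply: eq_bigr => z _.
rewrite -scalerN; congr (_ *: _); rewrite /coord -scaleNr; congr (_ *: _).
have -> : cmatrix e z.1 [ffun x => u (tperm i j x)] = xcol i j (cmatrix e z.1 u).
  by apply/matrixP => y x; rewrite !mxE ffunE.
by rewrite xcolE det_mulmx det_perm odd_tperm ij expr1 mulrN1.
Qed.

(** Contracting the coordinates computes the differential in [S], which vanishes only modulo [F].
    Fixing one error [quo] per pair of a vector and a coefficient makes the same [g] work for all
    slots [i], up to sign. *)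
Lemma cycle_quotient : exists g : {ffun 'I_p -> J d} -> S,
  (forall s, g s \is (k + d - e).-homog) /\
  forall i u, contract cycle_coord i u = (-1) ^+ i *: (F * g (rem_slot i u)).
Proof.
have /choice[quo quoP] : forall vm : fn * fn, exists Q, Q \is (k + d - e).-homog /\
    (sec d vm.1 -> sec k vm.2 ->
     rep e d vm.1 * rep e k vm.2 = rep e (k + d) (vm.1 * vm.2) + F * Q).
  move=> [v m]; have [[vd mk]|nvm] := pselect (sec d v /\ sec k m).
    by have [Q hQ E] := mul_rep vd mk; exists Q.
  by exists 0; split=> [|vd mk]; [exact: rpred0 | case: nvm].
pose D (q : seq fn) (l : nat) s := \det (cmatrix e (d := d) (p := p) (take l q ++ drop l.+1 q) s).
exists (fun s => \sum_(z <- dom c) coeff z c *: \sum_(l < p.+1)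
  (-1) ^+ l *: (D z.1 l s *: quo (nth 0 z.1 l, z.2))); split=> [s|i u].
  apply: rpred_sum => z _; apply/rpredZ/rpred_sum => l _.
  by apply/rpredZ/rpredZ; have [] := quoP (nth 0 z.1 l, z.2).
set s := rem_slot i u.
have diff_coord z : z \in dom c -> contracted e k s z.1 z.2 =
    fglift (coord e (k + d) s) (koszul_diff << z >>) +
    F * \sum_(l < p.+1) (-1) ^+ l *: (D z.1 l s *: quo (nth 0 z.1 l, z.2)).
  move=> /dom_gen[[sz] Vz Mz]; rewrite koszul_diff_gen linear_sum /= sz.
  rewrite mulr_sumr -big_split; apply: eq_bigr => l _ /=.
  rewrite fgliftZ /pure fgliftU /coord /= -!scalerAr -!scalerDr.
  congr (_ *: (_ *: _)).
  have [_ /= ->] // := quoP (nth 0 z.1 l, z.2).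
  by apply: Vz; rewrite mem_nth // sz.
transitivity (\sum_(z <- dom c) coeff z c *: ((-1) ^+ i *: contracted e k s z.1 z.2)).
  rewrite /contract; under eq_bigr do rewrite cycle_coordE mulr_suml.
  rewrite exchange_big; apply: eq_big_seq => z /dom_gen[[sz] Vz Mz] /=.
  have <- := contract_coord K_nc n_gt0 F_homog F_smooth F_top k z.2 i u sz Vz.
  rewrite scaler_sumr; apply: eq_bigr => j _; rewrite -scalerAl.
  by case: z {sz Vz Mz}.
rewrite mulr_sumr scaler_sumr.
have /(congr1 (fun x => (-1) ^+ i *: x)) :=
  coord_null K_nc n_gt0 F_homog F_smooth F_top s c_cycle.
rewrite scaler0 {1}[c]freeg_sumZ /koszul_diff 2!linear_sum /= scaler_sumr => E.
rewrite -[RHS]add0r -[X in _ = X + _]E -big_split; apply: eq_big_seq => z z_c /=.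
rewrite diff_coord // !linearZ /= -scalerAr !scalerDr.
by rewrite !scalerA ![coeff z c * _]mulrC.
Qed.

End Cycle.

End CycleQuotient.

Section CycleLift.
Variables (K : numClosedFieldType) (n e : nat) (F : {mpoly K[n.+2]}).
Hypothesis K_nc : not_countable K.
Hypothesis n_gt0 : (0 < n)%N.
Hypotheses (F_homog : F \is e.-homog) (F_smooth : smooth_hypersurface F).
Hypothesis F_top : F@_(U_(ord_max) *+ e) != 0.
Local Notation S := {mpoly K[n.+2]}.
Local Notation fn := (cone F -> K).
Local Notation sec k := (section_space (F := F) k%:Z).
Local Notation J d := (monomials n.+2 d).
Implicit Types (P Q : S) (v w m : fn).

Lemma monomials_inhabited d : exists j : J d, True.
Proof.
have [j _] : exists j : J d, mon j = (U_(ord0) *+ d)%MM.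
  by apply: mon_surj; rewrite mdegMn mdeg1 mul1n.
by exists j.
Qed.

Section Cycle.
Variables (d k p : nat).
Local Notation slots := {ffun 'I_p.+1 -> J d}.
Variable c : {freeg (wedge_gen K (cone F)) / K}.
Hypothesis c_chain : wedge_chain (sec d) (sec k) p.+1%:Z c.
Hypothesis c_cycle : wedge_null (sec d) (sec (k + d)) p%:Z (koszul_diff c).
Local Notation coordc := (@cycle_coord K n e F d k p c).

(** The square of the differential is zero: [F] times this contraction is a double contraction of
    the antisymmetric coordinates against the symmetric [x^j x^j'], so it equals its own negative.
    Then divide by 2 and by [F]. *)
Lemma quotient_syz (g : {ffun 'I_p -> J d} -> S) (s : {ffun 'I_p -> J d}) i :
  (forall i u, contract coordc i u = (-1) ^+ i *: (F * g (rem_slot i u))) ->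
  contract g i s = 0.
Proof.
move=> gE; have [j0 _] := monomials_inhabited d.
have Fg t : F * g t = \sum_j coordc (ins_slot ord0 j t) * 'X_[mon j].
  have := gE ord0 (ins_slot ord0 j0 t); rewrite ins_slotK expr0 scale1r => <-.
  by apply: eq_bigr => j _; rewrite upd_ins.
apply: (mulfI (F_neq0 F_top)); rewrite mulr0.
pose B j j' := coordc (ins_slot ord0 j' (upd s i j)).
have BN j j' : B j j' = - B j' j.
  rewrite /B -(cycle_coord_tperm _ _ _ _ (neq_lift ord0 i)).
  congr (coordc _); apply/ffunP => x; rewrite [RHS]ffunE.
  case: (unliftP ord0 x) => [y ->|->]; last first.
    by rewrite tpermL !ffunE unlift_none liftK ffunE eqxx.
  have [->|yi] := eqVneq y i.
    by rewrite tpermR !ffunE unlift_none liftK ffunE eqxx.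
  rewrite tpermD ?neq_lift // ?(inj_eq lift_inj) 1?eq_sym //.
  by rewrite !ffunE liftK !ffunE (negbTE yi).
have -> : F * contract g i s =
    \sum_j \sum_j' B j j' * ('X_[mon j] * 'X_[mon j']).
  rewrite /contract mulr_sumr; apply: eq_bigr => j _.
  rewrite mulrA Fg mulr_suml; apply: eq_bigr => j' _.
  by rewrite -mulrA; congr (_ * _); rewrite mulrC.
set X := \sum_j _; have : X = - X.
  rewrite {1}/X exchange_big /X -sumrN; apply: eq_bigr => j _.
  rewrite -sumrN; apply: eq_bigr => j' _.
  by rewrite BN mulNr [_ * 'X_[mon j]]mulrC.
move=> XN; have : (2%:R : K) *: X = 0 by rewrite scaler_nat mulr2n {1}XN addNr.
by move/eqP; rewrite scaler_eq0 pnatr_eq0 => /eqP.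
Qed.

(** [g] is the image of the cycle under the connecting map of [0 -> S(-e) -> S -> S/F -> 0]. It has
    [p] slots and coefficient degree [k - e + d], so it is a boundary as soon as [p <= k - e];
    subtracting [F] times a preimage corrects the coordinates without changing their
    restrictions. *)
Lemma cycle_lift : (e <= k)%N -> (p <= k - e)%N ->
  exists2 a : slots -> S, syz 0 [set: 'I_p.+1] k a &
    forall u, restr (F := F) (a u) = restr (coordc u).
Proof.
move=> le_ek le_p.
have [g [hg gE]] := cycle_quotient K_nc n_gt0 F_homog F_smooth F_top c_chain c_cycle.
have syz_g : syz 0 [set: 'I_p] (k - e + d) g.
  split=> [s|s i _ _|s i _]; last exact: quotient_syz.
    by apply/hlow_homog; rewrite addnC addnBA // addnC.
  exact/mlowP.
have [|h [syz_h ghE]] := syz_monomials _ syz_g; first by rewrite cardsT card_ord.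
(* In the contraction of slot [i] only the summand with [x^j] inserted in that slot survives, the
   [h j] being syzygies; the signs match those of [cycle_quotient]. *)
pose ht (u : slots) := \sum_(i < p.+1) (-1) ^+ i *: ext i h u.
exists (fun u => coordc u + - (F * ht u)) => [|u]; last first.
  apply: funext => y; rewrite /restr mevalB mevalM cone_zero mul0r subr0 //.
have contr_ht i u : contract ht i u = (-1) ^+ i *: g (rem_slot i u).
  transitivity (\sum_(i' < p.+1) (-1) ^+ i' *: contract (ext i' h) i u).
    rewrite /contract /ht; under eq_bigr do rewrite mulr_suml.
    rewrite exchange_big; apply: eq_bigr => i' _ /=.
    by rewrite scaler_sumr; apply: eq_bigr => j _; rewrite -scalerAl.
  rewrite (bigD1 i) //= [X in _ + X]big1 ?addr0 => [|i' ii'].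
    by rewrite contract_ext -ghE.
  case: (unliftP i' i) ii' => [i0 ->|->]; last by rewrite eqxx.
  move=> _; rewrite contract_ext_lift; have [_ _ ->] := syz_h (u i').
    by rewrite scaler0.
  by rewrite finset.in_setT.
split=> [u|u i _ _|u i _].
- apply/hlow_homog; apply: rpredB.
    exact: (cycle_coord_homog K_nc n_gt0 F_homog F_smooth F_top c_chain).
  rewrite -(subnKC le_ek); apply: dhomogM => //; apply: rpred_sum => i _.
  by apply: rpredZ; apply/hlow_homog; have [hh _ _] := syz_h (u i); apply: hh.
- exact/mlowP.
- transitivity (contract coordc i u - F * contract ht i u).
    rewrite /contract mulr_sumr -sumrB; apply: eq_bigr => j _.
    by rewrite mulrBl mulrA.
  by rewrite gE contr_ht scalerAr subrr.
Qed.

End Cycle.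
End CycleLift.

(** * Vanishing *)

Section Chains.
Variables (K : fieldType) (T : Type) (V M : set (T -> K)) (p : int).
Implicit Types (c : {freeg (wedge_gen K T) / K}).

Lemma wedge_chainD c c' : wedge_chain V M p c -> wedge_chain V M p c' ->
  wedge_chain V M p (c + c').
Proof.
move=> hc hc' g; have [c0|/hc //] := eqVneq (coeff g c) 0.
by rewrite coeffD c0 add0r => /hc'.
Qed.

Lemma wedge_chainZ a c : wedge_chain V M p c -> wedge_chain V M p (a *: c).
Proof. by move=> hc g; rewrite coeffZ mulf_eq0 negb_or => /andP[_ /hc]. Qed.

Lemma wedge_chain_sum (I : Type) (s : seq I) (f : I -> {freeg (wedge_gen K T) / K}) :
  (forall i, wedge_chain V M p (f i)) -> wedge_chain V M p (\sum_(i <- s) f i).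
Proof.
move=> hf; elim/big_ind: _ => //; first by move=> g; rewrite coeff0 eqxx.
exact: wedge_chainD.
Qed.

Lemma wedge_chain_pure v m : is_gen V M p (v, m) -> wedge_chain V M p (pure v m).
Proof.
by move=> hg g; rewrite coeffU mul1r; set b := (X in (nat_of_bool X)%:R);
  case: (boolP b) => [/eqP <- //|_]; rewrite eqxx.
Qed.

Lemma wedge_chain_neg c : p < 0 -> wedge_chain V M p c -> c = 0.
Proof.
move=> p0 hc; apply/eqP/freeg_eqP => g; rewrite coeff0.
apply/eqP; rewrite -[_ == _]negbK; apply/negP => /hc[sz _ _].
by rewrite -sz in p0.
Qed.

End Chains.

Section Exactness.
Variables (K : numClosedFieldType) (n e : nat) (F : {mpoly K[n.+2]}).
Hypothesis K_nc : not_countable K.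
Hypothesis n_gt0 : (0 < n)%N.
Hypotheses (F_homog : F \is e.-homog) (F_smooth : smooth_hypersurface F).
Hypothesis F_top : F@_(U_(ord_max) *+ e) != 0.
Local Notation S := {mpoly K[n.+2]}.
Local Notation fn := (cone F -> K).
Local Notation sec k := (section_space (F := F) k%:Z).
Local Notation J d := (monomials n.+2 d).
Local Notation rst := (restr (F := F)).

Lemma restr_sum (I : Type) (s : seq I) (c : I -> K) (f : I -> S) :
  rst (\sum_(i <- s) c i *: f i) = \sum_(i <- s) cst (c i) * rst (f i).
Proof.
apply: funext => y; rewrite /restr raddf_sum fct_sumE /=.
by apply: eq_bigr => i _; rewrite mevalZ.
Qed.

Variables (d k p : nat).
Local Notation slots := {ffun 'I_p -> J d}.
Let X (j : J d) : fn := rst 'X_[mon j].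

Let X_sec j : sec d (X j).
Proof. by apply: restr_section; rewrite dhomogX /= mdeg_mon. Qed.

Let sec_lin l : linear_set (sec l) := linear_sec K_nc n_gt0 F_homog F_smooth F_top l.

Local Notation eqvp := (eqv (sec d) (sec k) p%:Z).
Variable c : {freeg (wedge_gen K (cone F)) / K}.
Hypothesis c_chain : wedge_chain (sec d) (sec k) p%:Z c.

Lemma gen_vseq (w : 'I_p -> fn) m : (forall i, sec d (w i)) -> sec k m ->
  is_gen (sec d) (sec k) p%:Z (vseq w, m).
Proof.
move=> Vw Mm; split=> //=; first by rewrite size_vseq.
by move=> v /mem_vseq[i ->].
Qed.

Let gen_X (s : slots) m : sec k m -> is_gen (sec d) (sec k) p%:Z (vseq (X \o s), m).
Proof. by apply: gen_vseq => i; apply: X_sec. Qed.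

(** Antisymmetrization followed by projection back to the exterior power is multiplication by
    [p!]. *)
Lemma chain_coord : eqvp (p`!%:R *: c)
  (\sum_(s : slots) pure (vseq (X \o s)) (rst (fglift (coord e k s) c))).
Proof.
have Mrep (m : fn) : sec k (rst (rep e k m)).
  exact: rep_sec.
apply: (eqv_trans (y := \sum_(z <- dom c) coeff z c *: \sum_(s : slots)
   \det (cmatrix e z.1 s) *: pure (vseq (X \o s)) (rst (rep e k z.2)))).
  rewrite {1}[c]freeg_sumZ scaler_sumr !big_seq; apply: eqv_sum => z z_c.
  have [sz Vz Mz] : is_gen (sec d) (sec k) p%:Z z by apply: c_chain; rewrite -mem_dom.
  rewrite scalerA mulrC -scalerA; apply: eqvZ; apply: eqv_sym.
  have Vz' (i : 'I_p) : sec d (nth 0 z.1 i).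
    by apply: Vz; rewrite mem_nth //; case: sz => ->.
  have [_ <-] := repP K_nc n_gt0 F_homog F_smooth F_top Mz.
  have zE : z = (vseq (fun i : 'I_p => nth 0 z.1 i), z.2).
    by rewrite -vseq_nth; [case: (z) | case: sz].
  rewrite [X in <<X>>]zE -/(pure _ _).
  apply: (eqv_det (sec_lin d) _ _ (X := X)
    (c := fun i j => (rep e d (nth 0 z.1 i))@_(mon j))) => //.
    by move=> w Vw; apply: gen_vseq.
  by move=> i; apply: (sec_mon K_nc n_gt0 F_homog F_smooth F_top).
under eq_bigr do rewrite scaler_sumr.
rewrite exchange_big; apply: eqv_sum => s _.
rewrite fglift_sumE.
have -> : \sum_(z <- dom c) coeff z c *: coord e k s z =
    \sum_(z <- dom c) (coeff z c * \det (cmatrix e z.1 s)) *: rep e k z.2.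
  by apply: eq_bigr => z _; rewrite /coord scalerA.
rewrite restr_sum; apply: eqv_sym.
under [X in eqv _ _ _ _ X]eq_bigr do rewrite scalerA.
apply: (eqv_coef_sum (sec_lin k)) => [m Mm|z //].
exact: gen_X.
Qed.

Lemma pure_zero v : (forall m, sec k m -> is_gen (sec d) (sec k) p%:Z (v, m)) ->
  eqvp (pure v (rst 0)) 0.
Proof.
move=> g; have := eqv_coef_sum (sec_lin k) ([::] : seq 'I_0) (fun=> 0) (f := fun=> rst 0) g.
rewrite !big_nil (_ : rst 0 = 0); last by apply: funext => y; rewrite /restr meval0.
by apply=> -[].
Qed.

(** Removing slot 0 multiplies [b j] by [x^j] and gives the right side. Removing any later slot
    contracts a slot of some [b j], which gives zero. *)
Lemma diff_chain (b : J d -> slots -> S) l : (forall j s, b j s \is l.-homog) ->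
  (l + d)%N = k ->
  (forall j i s, contract (b j) i s = 0) ->
  eqvp (koszul_diff (\sum_(u : {ffun 'I_p.+1 -> J d})
          pure (vseq (X \o u)) (rst (ext ord0 b u))))
    (\sum_(s : slots) pure (vseq (X \o s)) (rst (\sum_j b j s * 'X_[mon j]))).
Proof.
move=> hb ldk cb.
have -> : koszul_diff (\sum_(u : {ffun 'I_p.+1 -> J d})
     pure (vseq (X \o u)) (rst (ext ord0 b u))) =
  \sum_(i < p.+1) (-1) ^+ i *: \sum_(s : slots) \sum_j
     pure (vseq (X \o s)) (rst (ext ord0 b (ins_slot i j s) * 'X_[mon j])).
  rewrite /koszul_diff linear_sum /= -/koszul_diff.
  under eq_bigr do rewrite -/(koszul_diff _) koszul_diff_vseq.
  rewrite exchange_big; apply: eq_bigr => i _ /=; rewrite -scaler_sumr; congr (_ *: _).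
  rewrite (sum_ins_slot _ i); apply: eq_bigr => s _; apply: eq_bigr => j _.
  rewrite (eq_vseq (w := X \o s)) => [|x /=]; last by rewrite ffunE liftK.
  rewrite ins_slot_id; congr pure; apply: funext => y.
  by rewrite /X /restr mevalM mulrC.
have sumE (i : 'I_p.+1) (s : slots) : eqvp (\sum_j pure (vseq (X \o s))
      (rst (ext ord0 b (ins_slot i j s) * 'X_[mon j])))
    (pure (vseq (X \o s)) (rst (\sum_j ext ord0 b (ins_slot i j s) * 'X_[mon j]))).
  apply: eqv_sym; have /(_ (sec d)) := @eqv_coef_sum _ _ _ _ p%:Z (sec_lin k) (vseq (X \o s)) _
    (index_enum (J d)) (fun=> 1) (fun j => rst (ext ord0 b (ins_slot i j s) * 'X_[mon j])).
  rewrite -restr_sum; under eq_bigr do rewrite /= scale1r.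
  under [X in eqv _ _ _ _ X]eq_bigr do rewrite /= scale1r.
  apply=> [m Mm|j]; first exact: gen_X.
  by apply: restr_section; rewrite -ldk; apply: dhomogM;
    [exact: hb | rewrite dhomogX /= mdeg_mon].
rewrite big_ord_recl expr0 scale1r -[X in eqv _ _ _ _ X]addr0.
apply: eqvD.
  apply: eqv_sum => s _; apply: eqv_trans (sumE _ _) _.
  rewrite (eq_bigr (fun j => b j s * 'X_[mon j])) => [|j _]; first exact: eqv_refl.
  by rewrite /ext ins_slot_id ins_slotK.
apply: eqv_sum0 => i;
  rewrite -[X in eqv _ _ _ _ X](scaler0 _ ((-1) ^+ fintype.lift ord0 i)); apply: eqvZ.
apply: eqv_sum0 => s; apply: eqv_trans (sumE _ _) _.
rewrite sum_ins_contract => [|u]; last by rewrite contract_ext_lift cb.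
by apply: pure_zero => m Mm; apply: gen_X.
Qed.

(** The bound [d + p <= k] lets the lifted cycle with its [p] slots split off monomials of degree
    [d]; the bound [e + p <= k.+1] does the same for its quotient by [F], which has one slot
    less. *)
Lemma koszul_exact_nat : (d + p <= k)%N -> (e + p <= k.+1)%N -> (e <= k)%N ->
  wedge_null (sec d) (sec (k + d)) (p%:Z - 1) (koszul_diff c) ->
  exists2 b, wedge_chain (sec d) (sec (k - d)) (p%:Z + 1) b &
    wedge_null (sec d) (sec k) p%:Z (c - koszul_diff b).
Proof.
move=> le_dp le_ep le_e c_cycle.
have [a syz_a aE] : exists2 a : slots -> S, syz 0 [set: 'I_p] k a &
    forall u, rst (a u) = rst (fglift (coord e k u) c).
  (* For [p = 0] there are no slots to contract, so the coordinates need no correction. *)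
  case: p c_chain c_cycle le_dp le_ep => [|p'] chain cycle _ le_ep.
    exists (fun u => fglift (coord e k u) c) => //; split=> [u|u []|u []] //.
    apply/hlow_homog; rewrite fglift_sumE big_seq; apply: rpred_sum => z.
    rewrite mem_dom => /chain[_ _ zk].
    by apply/rpredZ/rpredZ; apply: (rep_homog K_nc n_gt0 F_homog F_smooth F_top).
  apply: (cycle_lift K_nc n_gt0 F_homog F_smooth F_top chain) => //.
    have E : p'.+1%:Z - 1 = p'%:Z by rewrite -addn1 PoszD addrK.
    by move: cycle; rewrite E.
  by rewrite leq_subRL // -ltnS -addnS.
have le_dk : (d <= k)%N by apply: leq_trans le_dp; apply: leq_addr.
have [||b [syz_b abE]] := @syz_monomials _ _ d _ [set: 'I_p] (k - d) a.
- by rewrite cardsT card_ord leq_subRL.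
- by rewrite subnK.
pose beta := \sum_(u : {ffun 'I_p.+1 -> J d}) pure (vseq (X \o u)) (rst (ext ord0 b u)).
have hb j s : b j s \is (k - d).-homog.
  by apply/hlow_homog; have [h _ _] := syz_b j; apply: h.
exists ((p`!%:R)^-1 *: beta).
  apply: wedge_chainZ; apply: wedge_chain_sum => u; apply: wedge_chain_pure.
  split=> /=; first by rewrite size_vseq -addn1 PoszD.
    by move=> v /mem_vseq[i ->]; apply: X_sec.
  by apply: restr_section; apply: hb.
have p0 : (p`!%:R : K) != 0 by rewrite pnatr_eq0 -lt0n fact_gt0.
have -> : c = (p`!%:R)^-1 *: (p`!%:R *: c) by rewrite scalerA mulVf // scale1r.
have -> : koszul_diff ((p`!%:R)^-1 *: beta) = (p`!%:R)^-1 *: koszul_diff beta.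
  exact: fgliftZ.
apply: eqvZ; apply: eqv_trans chain_coord _; apply: eqv_sym.
apply: eqv_trans (diff_chain hb _ _) _; first by rewrite subnK.
  by move=> j i s; have [_ _ h] := syz_b j; apply: h; rewrite finset.in_setT.
apply: eqv_sum => s _; rewrite -aE abE; exact: eqv_refl.
Qed.

End Exactness.

Lemma proper_closed_top (K : fieldType) (r e : nat) (t : 'I_r) :
  proper_closed e (fun F : {mpoly K[r]} => F@_(U_(t) *+ e) = 0).
Proof.
have [j jE] : exists j : monomials r e, mon j = (U_(t) *+ e)%MM.
  by apply: mon_surj; rewrite mdegMn mdeg1 mul1n.
split.
  exists (fun g => g = 'X_(enum_rank j)); split.
    by move=> g ->; exists 1%N; rewrite dhomogX /= mdeg1.
  move=> F _; rewrite -jE; split=> [F0 g ->|/(_ _ erefl)];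
    by rewrite mevalXU /form_coefs enum_rankK.
exists 'X_[U_(t) *+ e]; last by rewrite mcoeffX eqxx => /eqP; rewrite oner_eq0.
by split; [rewrite dhomogX /= mdegMn mdeg1 mul1n | rewrite -msupp_eq0 msuppX].
Qed.

Theorem theorem1 (R : realType) (n : nat) (hn : (1 <= n)%N) :
  exists d0 : int, forall d : int, d0 <= d ->
    @for_very_general_smooth R[i] n.+2 n.+2
      (fun F => forall p q : int, p <= (q - 1) * d - 3 ->
         koszul_vanishes F d p q).
Proof.
(* [d0] is the degree [e = n + 2] of the hypersurface: with [e <= d], the inequality [d + p <= k]
   implies the one between [e + p] and [k.+1]. *)
exists n.+2%:Z => -[d|//] le_d.
exists (fun _ F => F@_(U_(ord_max) *+ n.+2) = 0);
  split=> [_|F [F_homog _] F_smooth F_top].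
  exact: proper_closed_top.
have {}F_top : F@_(U_(ord_max) *+ n.+2) != 0 by apply/eqP; apply: (F_top 0%N).
(* For negative [p] the only chain is zero. *)
move=> [p|p] q le_p c c_chain c_cycle; last first.
  exists 0; first by move=> g; rewrite coeff0 eqxx.
  rewrite (wedge_chain_neg _ c_chain) // /koszul_diff linear0 subr0.
  exact: wedge_null0.
have d_gt0 : (0 < d)%N by apply: leq_trans le_d.
(* With [p >= 0] the hypothesis makes [(q - 1) * d] positive, so [q >= 2] and all the degrees
   involved are natural numbers. *)
have [m qE] : exists m : nat, q = m.+2%:Z.
  case: q le_p {c_chain c_cycle} => [[|[|m]]|m] le_p; last 1 first.
  - by exfalso; move: le_p; rewrite NegzE; nia.
  - by exfalso; move: le_p; nia.
  - by exfalso; move: le_p; nia.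
  - by exists m.
have kE : q * d%:Z = (m.+2 * d)%N%:Z by rewrite qE PoszM.
have kB : (q - 1) * d%:Z = (m.+2 * d - d)%N%:Z.
  by rewrite mulrBl mul1r kE subzn // leq_pmull.
have kD : (q + 1) * d%:Z = (m.+2 * d + d)%N%:Z by rewrite mulrDl mul1r kE PoszD.
rewrite kE in c_chain; rewrite kD in c_cycle.
rewrite kE kB; rewrite kB in le_p.
have nc := @complex_not_countable R.
apply: (koszul_exact_nat nc hn F_homog F_smooth F_top c_chain) => //; move: le_p le_d;
  nia.
Qed.
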